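(* In the setting described in the context (discrete or continuous case), assume $\{\Pi_r^Y\}$ is uniformly bounded in operator norm whenever $s_X=\infty$. If $y=K^Yg$ for some $g\in S$, then $\Pi_r^Yy\to y$ in $Y$ as $r$ increases and the following error bound holds: $$\|\Pi_r^Yy-y\|_Y\le\sum_{k>r}\sigma_k\,|(g,f_k)_S|\,\|\Pi_r^YL\varphi_k-L\varphi_k\|_Y .$$ Also, if the POD eigenvalues for the data $\{Lw_j\}$ are all nonzero, then $\Pi_r^Yy\to y$ for all $y\in Y$.
   Context: Scalars are $\mathbb{K}=\mathbb{R}$ or $\mathbb{C}$; inner products are linear in the first argument. $X,Y$ are separable Hilbert spaces and $L:\mathcal{D}(L)\subset X\to Y$ is a linear operator, possibly unbounded. Discrete case: $s\ge1$, weights $\gamma_1,\dots,\gamma_s>0$, $S=\mathbb{K}^s$ with $(u,v)_S=\sum_{j=1}^s\gamma_ju_j\overline{v_j}$, data $\{w_j\}_{j=1}^s\subset\mathcal{D}(L)$, and POD operator $K:S\to X$, $Kf=\sum_{j=1}^s\gamma_jf_jw_j$. Continuous case: $\mathcal{O}\subset\mathbb{R}^d$ open, $m\ge1$, $S=L^2(\mathcal{O};\mathbb{K}^m)$, data $\{w_j\}_{j=1}^m\subset L^2(\mathcal{O};X)$, POD operator $K:S\to X$, $Kf=\sum_{j=1}^m\int_{\mathcal{O}}f_j(t)w_j(t)\,dt$; it is assumed that $w_j(t)\in\mathcal{D}(L)$ a.e., $Lw_j\in L^2(\mathcal{O};Y)$, and for all $f\in S$, $Kf\in\mathcal{D}(L)$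 and $LKf=\sum_{j=1}^m\int_{\mathcal{O}}f_j(t)Lw_j(t)\,dt$. In both cases $K$ is compact with singular value decomposition $Kf=\sum_{k\ge1}\sigma_k(f,f_k)_S\varphi_k$, $\sigma_1\ge\sigma_2\ge\dots\ge0$, with orthonormal singular vectors $\{f_k\}\subset S$, $\{\varphi_k\}\subset X$. $s_X=\mathrm{rank}(K)\in\mathbb{N}\cup\{\infty\}$, so $\sigma_k>0$ exactly for $k\le s_X$, and then $\varphi_k=\sigma_k^{-1}Kf_k\in\mathcal{D}(L)$. $K^Y=LK:S\to Y$ is the (compact) POD operator for the data $\{Lw_j\}$; the POD eigenvalues for $\{Lw_j\}$ are the eigenvalues of $K^Y(K^Y)^*:Y\to Y$. In sums over $k>r$, terms with $\sigma_k=0$ are taken to be zero. For each positive integer $r$ with $\sigma_r>0$: $X_r=\mathrm{span}\{\varphi_k\}_{k=1}^r\subset\mathcal{D}(L)$; $Y_r=LX_r$; $\Pi_r^Y:Y\to Y$ is a bounded linear projection onto $Y_r$, not necessarily orthogonal. Uniformly bounded means $\|\Pi_r^Y\|\le C$ for all such $r$, with $C$ independent of $r$. ''As $r$ increases'' means $r=1,2,\dots$ with $r\le s_X$: if $s_X=\infty$ it is the limit $r\to\infty$; if $s_X<\infty$, convergence to a limit means that the limit is attained at $r=s_X$. *)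

(* Defs.v *)
From HB Require Import structures.
From mathcomp Require Import all_boot all_order all_algebra.
From mathcomp Require Import all_classical all_reals all_analysis.
From mathcomp Require Import complex.

Set Implicit Arguments.
Unset Strict Implicit.
Unset Printing Implicit Defensive.

Import Order.TTheory GRing.Theory Num.Theory.
Import numFieldNormedType.Exports.

Local Open Scope classical_set_scope.
Local Open Scope ring_scope.

Inductive scalars := RealScalars | ComplexScalars.

Definition scalar_field (R : realType) (k : scalars) : numFieldType :=
  match k with RealScalars => R | ComplexScalars => R[i] end.

Definition re_part (R : realType) (k : scalars) : scalar_field R k -> R :=
  match k with RealScalars => id | ComplexScalars => @complex.Re R end.

Definition im_part (R : realType) (k : scalars) : scalar_field R k -> R :=
  match k with RealScalars => fun=> 0 | ComplexScalars => @complex.Im R end.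

(* The imaginary part is dropped in the real case, where it is only ever 0. *)
Definition mk_scalar (R : realType) (k : scalars) : R -> R -> scalar_field R k :=
  match k with
  | RealScalars => fun a _ => a
  | ComplexScalars => fun a b => Complex a b
  end.

Definition of_real (R : realType) (k : scalars) (a : R) : scalar_field R k :=
  mk_scalar k a 0.

Definition conj_scalar (R : realType) (k : scalars) : scalar_field R k -> scalar_field R k :=
  match k with RealScalars => id | ComplexScalars => @conjc R end.

(* The library norm `|v| lies in the scalar field, which may be complex;
   rnorm v is the same number, read in R. *)
Definition rnorm (R : realType) (k : scalars) (V : normedModType (scalar_field R k))
  (v : V) : R := re_part `|v|.

Definition scalar_abs (R : realType) (k : scalars) (z : scalar_field R k) : R :=
  re_part `|z|.

(* The inner product, linear in its first argument, induces the norm of V;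
   together with completeness of V this makes V a Hilbert space. *)
Definition hilbert_dot (R : realType) (k : scalars)
    (V : completeNormedModType (scalar_field R k))
    (dot : {dot V for @conj_scalar R k}) : Prop :=
  forall v : V, dot v v = `|v| ^+ 2.

Definition separable_space (V : topologicalType) : Prop :=
  exists2 A : set V, countable A & dense A.

(* A possibly unbounded operator with domain D is a total function, linear on
   the subspace D; its values outside D are meaningless. *)
Definition linear_operator (F : numFieldType) (U V : lmodType F)
    (D : set U) (L : U -> V) : Prop :=
  D 0 /\ forall (a : F) (x y : U), D x -> D y ->
    D (a *: x + y) /\ L (a *: x + y) = a *: L x + L y.

Section bochner.
Context {d : measure_display} {T : measurableType d} {R : realType}.
Context {k : scalars}.
Variables (mu : {measure set T -> \bar R}) (D : set T).
Variable V : normedModType (scalar_field R k).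

Record simple_function := SimpleFunction {
  simple_size : nat;
  simple_set : 'I_simple_size -> set T;
  simple_val : 'I_simple_size -> V;
  simple_measurable : forall i, measurable (simple_set i);
  simple_sub : forall i, simple_set i `<=` D;
  simple_finite : forall i, (mu (simple_set i) < +oo)%E }.

Definition simple_eval (s : simple_function) (t : T) : V :=
  \sum_i (\1_(simple_set (s:=s) i) t : scalar_field R k) *: simple_val i.

Definition simple_integral (s : simple_function) : V :=
  \sum_i of_real k (fine (mu (simple_set (s:=s) i))) *: simple_val i.

Definition strongly_measurable (f : T -> V) : Prop :=
  exists s : nat -> simple_function,
    forall t, D t -> simple_eval (s n) t @[n --> \oo] --> f t.

Definition is_bochner_integral (f : T -> V) (v : V) : Prop :=
  exists g : T -> V,
    [/\ strongly_measurable g, f = g %[ae mu in D] &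
     exists s : nat -> simple_function,
       ((\int[mu]_(t in D) (rnorm (g t - simple_eval (s n) t))%:E)%E
          @[n --> \oo] --> (0 : \bar R)%E) /\
       (simple_integral (s n) @[n --> \oo] --> v)].

(* By convention 0 when f is not Bochner integrable. *)
Definition bochner_integral (f : T -> V) : V :=
  xget 0 [set v | is_bochner_integral f v].

(* Only the almost everywhere class of f matters. *)
Definition bochner_L2 (f : T -> V) : Prop :=
  exists g : T -> V,
    [/\ strongly_measurable g, f = g %[ae mu in D] &
     (\int[mu]_(t in D) (rnorm (g t) ^+ 2)%:E < +oo)%E].

End bochner.

Section scalar_integral.
Context {d : measure_display} {T : measurableType d} {R : realType}.
Context {k : scalars}.
Variables (mu : {measure set T -> \bar R}) (D : set T).

Definition scalar_integral (f : T -> scalar_field R k) : scalar_field R k :=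
  mk_scalar k (\int[mu]_(t in D) re_part (f t))
              (\int[mu]_(t in D) im_part (f t)).

Definition scalar_L2 (f : T -> scalar_field R k) : Prop :=
  [/\ measurable_fun D (fun t => re_part (f t)),
      measurable_fun D (fun t => im_part (f t)) &
      (\int[mu]_(t in D) (scalar_abs (f t) ^+ 2)%:E < +oo)%E].

End scalar_integral.

(* R^n as n-tuples with the product (hence Borel) sigma-algebra. *)
Notation Rn R n := (n.-tuple (measurableTypeR R)).

Definition cons_Rn (R : realType) (n : nat)
    (p : (measurableTypeR R * Rn R n)%type) : Rn R n.+1 :=
  [the n.+1.-tuple (measurableTypeR R) of p.1 :: p.2].

Lemma measurable_cons_Rn (R : realType) (n : nat) :
  measurable_fun [set: (measurableTypeR R * Rn R n)%type] (@cons_Rn R n).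
Proof. exact: measurable_cons. Qed.

(* The image of lebesgue_measure \x^ mu under cons_Rn. The canonical measure
   structure of pushforward is named because it needs the measurability proof. *)
Definition cons_measure (R : realType) (n : nat)
    (mu : {measure set (Rn R n) -> \bar R}) :
    {measure set (Rn R n.+1) -> \bar R} :=
  measure_function_pushforward__canonical__measure_function_Measure
    (@lebesgue_measure R \x^ mu)%E (@measurable_cons_Rn R n).

Fixpoint lebesgue_Rn (R : realType) (n : nat) :
    {measure set (Rn R n) -> \bar R} :=
  match n with
  | 0%N => dirac [tuple]
  | m.+1 => cons_measure (lebesgue_Rn R m)
  end.

Lemma measurable_box_Rn (R : realType) (n : nat) (A : 'I_n -> set R) :
  (forall i, measurable (A i)) ->
  measurable [set x : Rn R n | forall i, A i (tnth x i)].
Proof.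
move=> mA.
rewrite (_ : [set x | _] =
  \bigcap_(i in [set: 'I_n]) ((fun x : Rn R n => tnth x i) @^-1` A i));
  last first.
  by apply/seteqP; split => [x H i _|x H i]; [exact: (H i)|exact: (H i I)].
apply: fin_bigcap_measurable => [|i _]; first exact: finite_finset.
rewrite -[X in measurable X]setTI.
exact: (@measurable_tnth _ (measurableTypeR R) n i measurableT _ (mA i)).
Qed.


Lemma lebesgue_Rn_box (R : realType) (n : nat) (a b : 'I_n -> R) :
  (forall i, a i <= b i) ->
  lebesgue_Rn R n [set x | forall i, a i < tnth x i <= b i] =
  (\prod_i (b i - a i))%:E.
Proof.
elim: n a b => [|n IH] a b ab.
  rewrite big_ord0 /= diracE mem_set//= => -[]//.
rewrite /= /pushforward.
rewrite (_ : _ @^-1` _ = [set` `]a ord0, b ord0]%R] `*`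
    [set x : Rn R n |
       forall i, a (lift ord0 i) < tnth x i <= b (lift ord0 i)]); last first.
  apply/seteqP; split => [[x y] /= H|[x y] /= [H1 H2] i].
    split.
      by have := H ord0; rewrite in_itv.
    by move=> i; have := H (lift ord0 i); rewrite tnthS.
  case: (unliftP ord0 i) => [j ->|->]; first by rewrite tnthS; exact: H2.
  by move: H1; rewrite in_itv.
rewrite product_measure2E; last 2 first.
- exact: measurable_itv.
- apply: (@measurable_box_Rn R n
    (fun i => [set` `]a (lift ord0 i), b (lift ord0 i)]%R])) => i.
  exact: measurable_itv.
rewrite big_ord_recl EFinM; congr (_ * _)%E; last exact: IH.
apply: etrans (lebesgue_measure_itv _) _; rewrite /= lte_fin.
by have := ab ord0; rewrite le_eqVlt => /predU1P[->|->]; rewrite ?ltxx ?subrr.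
Qed.

Definition open_Rn (R : realType) (n : nat) (Omega : set (Rn R n)) : Prop :=
  open [set x : 'rV[R]_n | Omega [tuple x ord0 i | i < n]].
Arguments open_Rn {R n} Omega.

(* Discrete: S = K^s with weights gamma. Continuous: S = L^2(Omega; K^m) with Omega in
   R^d. *)
Inductive pod_setting (R : realType) :=
  | Discrete (s : nat) (gamma : 'I_s -> R)
  | Continuous (d : nat) (Omega : set (Rn R d)) (m : nat).
Arguments Discrete {R} s gamma.
Arguments Continuous {R} d Omega m.

Definition pod_setting_ok (R : realType) (P : pod_setting R) : Prop :=
  match P with
  | Discrete s gamma => (0 < s)%N /\ forall j, 0 < gamma j
  | Continuous d Omega m => open_Rn Omega /\ (0 < m)%N
  end.

(* In the continuous case elements of S are represented by square integrable
   Borel functions; all notions below depend only on their values almost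
   everywhere. *)
Definition S_rep (R : realType) (k : scalars) (P : pod_setting R) : Type :=
  match P with
  | Discrete s _ => 'I_s -> scalar_field R k
  | Continuous d _ m => Rn R d -> 'I_m -> scalar_field R k
  end.

Definition in_S (R : realType) (k : scalars) (P : pod_setting R) :
    S_rep k P -> Prop :=
  match P return S_rep k P -> Prop with
  | Discrete _ _ => fun=> True
  | Continuous d Omega _ => fun f =>
      forall j, scalar_L2 (lebesgue_Rn R d) Omega (fun t => f t j)
  end.

Definition dot_S (R : realType) (k : scalars) (P : pod_setting R) :
    S_rep k P -> S_rep k P -> scalar_field R k :=
  match P return S_rep k P -> S_rep k P -> scalar_field R k with
  | Discrete _ gamma => fun u v =>
      \sum_j of_real k (gamma j) * u j * conj_scalar (v j)
  | Continuous d Omega _ => fun u v =>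
      \sum_j scalar_integral (lebesgue_Rn R d) Omega
        (fun t => u t j * conj_scalar (v t j))
  end.

Definition pod_data (R : realType) (P : pod_setting R) (V : Type) : Type :=
  match P with
  | Discrete s _ => 'I_s -> V
  | Continuous d _ m => 'I_m -> Rn R d -> V
  end.

Definition map_data (R : realType) (P : pod_setting R) (U V : Type)
    (L : U -> V) : pod_data P U -> pod_data P V :=
  match P return pod_data P U -> pod_data P V with
  | Discrete _ _ => fun w j => L (w j)
  | Continuous _ _ _ => fun w j t => L (w j t)
  end.

Definition pod_operator (R : realType) (k : scalars) (P : pod_setting R)
    (V : normedModType (scalar_field R k)) : pod_data P V -> S_rep k P -> V :=
  match P return pod_data P V -> S_rep k P -> V with
  | Discrete _ gamma => fun w f =>
      \sum_j (of_real k (gamma j) * f j) *: w j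
  | Continuous d Omega _ => fun w f =>
      \sum_j bochner_integral (lebesgue_Rn R d) Omega (fun t => f t j *: w j t)
  end.

Definition pod_data_ok (R : realType) (k : scalars) (P : pod_setting R)
    (X Y : normedModType (scalar_field R k)) (D : set X) (L : X -> Y) :
    pod_data P X -> Prop :=
  match P return pod_data P X -> Prop with
  | Discrete s gamma => fun w => forall j, D (w j)
  | Continuous d Omega m => fun w =>
      (forall j,
        [/\ bochner_L2 (lebesgue_Rn R d) Omega (w j),
            (\forall t \ae lebesgue_Rn R d, Omega t -> D (w j t)) &
            bochner_L2 (lebesgue_Rn R d) Omega (fun t => L (w j t))]) /\
      (forall f : S_rep k (Continuous d Omega m), in_S f ->
         D (@pod_operator R k (Continuous d Omega m) X w f) /\
         L (@pod_operator R k (Continuous d Omega m) X w f) =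
         @pod_operator R k (Continuous d Omega m) Y
           (@map_data R (Continuous d Omega m) X Y L w) f)
  end.

(* Singular values and vectors are indexed from 1. Singular vectors with
   singular value 0 do not contribute to the expansion and are left
   unconstrained; this also covers S of finite dimension, where there is no
   infinite orthonormal sequence. *)
Definition is_svd (R : realType) (k : scalars) (P : pod_setting R)
    (X : completeNormedModType (scalar_field R k))
    (dotX : {dot X for @conj_scalar R k}) (K : S_rep k P -> X)
    (sigma : nat -> R) (f : nat -> S_rep k P) (phi : nat -> X) : Prop :=
  [/\ forall i, (0 < i)%N -> 0 <= sigma i.+1 <= sigma i,
      forall i, (0 < i)%N -> 0 < sigma i -> in_S (f i),
      forall i j, (0 < i)%N -> (0 < j)%N -> 0 < sigma i -> 0 < sigma j ->
        dot_S (f i) (f j) = (i == j)%:R,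
      forall i j, (0 < i)%N -> (0 < j)%N -> 0 < sigma i -> 0 < sigma j ->
        dotX (phi i) (phi j) = (i == j)%:R &
      forall g, in_S g ->
        \sum_(1 <= i < n) (of_real k (sigma i) * dot_S g (f i)) *: phi i
          @[n --> \oo] --> K g].

Definition linearly_independent (F : numFieldType) (V : lmodType F) (n : nat)
    (v : 'I_n -> V) : Prop :=
  forall a : 'I_n -> F, \sum_i a i *: v i = 0 -> forall i, a i = 0.

Definition rank_ge (R : realType) (k : scalars) (P : pod_setting R)
    (V : normedModType (scalar_field R k)) (K : S_rep k P -> V) (n : nat) : Prop :=
  exists g : 'I_n -> S_rep k P,
    (forall i, in_S (g i)) /\ linearly_independent (fun i => K (g i)).

(* The rank is the dimension of the range; None stands for infinity. *)
Definition has_rank (R : realType) (k : scalars) (P : pod_setting R)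
    (V : normedModType (scalar_field R k)) (K : S_rep k P -> V) (sX : option nat) :
    Prop :=
  match sX with
  | Some n => rank_ge K n /\ ~ rank_ge K n.+1
  | None => forall n, rank_ge K n
  end.

(* h represents T^* y. *)
Definition adjoint_at (R : realType) (k : scalars) (P : pod_setting R)
    (Y : completeNormedModType (scalar_field R k))
    (dotY : {dot Y for @conj_scalar R k}) (T : S_rep k P -> Y)
    (y : Y) (h : S_rep k P) : Prop :=
  in_S h /\ forall g, in_S g -> dotY (T g) y = dot_S g h.

Definition pod_eigenvalue (R : realType) (k : scalars) (P : pod_setting R)
    (Y : completeNormedModType (scalar_field R k))
    (dotY : {dot Y for @conj_scalar R k}) (T : S_rep k P -> Y)
    (lambda : scalar_field R k) : Prop :=
  exists y : Y, y != 0 /\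
    exists2 h, adjoint_at dotY T y h & T h = lambda *: y.

Definition span_upto (F : numFieldType) (V : lmodType F) (phi : nat -> V)
    (r : nat) : set V :=
  [set x | exists a : nat -> F, x = \sum_(1 <= i < r.+1) a i *: phi i].

Definition operator_norm_le (R : realType) (k : scalars)
    (V : normedModType (scalar_field R k)) (A : V -> V) (C : R) : Prop :=
  forall v, rnorm (A v) <= C * rnorm v.

Definition bounded_projection_onto (R : realType) (k : scalars)
    (V : normedModType (scalar_field R k)) (A : {linear V -> V}) (W : set V) : Prop :=
  [/\ exists C, operator_norm_le A C, forall v, A (A v) = A v &
      range A = W].

(* If the rank n is finite, converging means being equal to the limit at r = n;
   for n = 0 there is no r. *)
Definition converges_with_rank (V : topologicalType) (sX : option nat)
    (u : nat -> V) (l : V) : Prop :=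
  match sX with
  | Some n => (0 < n)%N -> u n = l
  | None => u r @[r --> \oo] --> l
  end.

(* Main.v *)
Require Import Defs.
From mathcomp Require Import all_boot all_order all_algebra.
From mathcomp Require Import all_classical all_reals all_analysis.
From mathcomp Require Import measurable_realfun complex ring lra.

Import Order.TTheory GRing.Theory Num.Theory.
Import numFieldNormedType.Exports.
Local Open Scope classical_set_scope.
Local Open Scope ring_scope.

Set Implicit Arguments.
Unset Strict Implicit.
Unset Printing Implicit Defensive.

(** Write T = L K, y = T g, c_i = (g, f_i), and let y_n be the sum of
    sigma_i c_i L phi_i over i <= n.  The heart of the matter is that y_n
    converges to y although L may be unbounded and is not assumed closed
    (pod_partial_sum_cvg).  If the rank is finite, K g is itself a finite sum and
    there is nothing to prove.  Otherwise S is an L^2 space.  Subtracting from g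
    its components along f_1, ..., f_n leaves a residual h_n with
    T h_n = y - y_n; the squared norms of the h_n decrease, so h_n is Cauchy and
    converges in S to some h orthogonal to every f_i (residual_cauchy,
    S_complete).  The singular value expansion gives K h = 0, hence T h = L 0 = 0.
    Finally T is continuous on S, being an integral operator with square
    integrable kernel (pod_operator_bound), so T h_n tends to T h = 0.

    The projection Pi_r fixes L phi_i for i <= r.  Hence Pi_r y_n - y_n is the
    sum of sigma_i c_i (Pi_r L phi_i - L phi_i) over r < i <= n, and letting n
    grow gives the error bound.  It also fixes y_r, so Pi_r y - y is
    (Pi_r - I) (y - y_r), which tends to 0 when the Pi_r are uniformly bounded.

    For the last claim, a vector orthogonal to the range of T is in the kernel of
    the adjoint of T, so it would be an eigenvector of T T^* for the eigenvalue 0.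
    If 0 is not an eigenvalue, the range is therefore dense (pod_image_dense), and
    uniform boundedness extends the convergence from the range to all of Y.

    Continuity of T rests on the inequality between the norm of a Bochner
    integral and the integral of the norm (rnorm_bochner_integral_le), and
    completeness of S on the Riesz-Fischer theorem (riesz_fischer). *)

(** * Real and complex scalars, treated uniformly *)

Section scalar_parts.
Context {R : realType} {k : scalars}.
Local Notation F := (scalar_field R k).
Implicit Types (x y z : F) (a b : R).

(** Both scalar fields are handled at once by comparing real and imaginary
    parts. *)
Lemma scalar_ext x y : re_part x = re_part y -> im_part x = im_part y -> x = y.
Proof. by case: k x y => //= -[a b] [c d] /= -> ->. Qed.

Lemma re_partD x y : re_part (x + y) = re_part x + re_part y.
Proof. by case: k x y => //= -[a b] [c d]. Qed.
Lemma im_partD x y : im_part (x + y) = im_part x + im_part y.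
Proof. by case: k x y => //= [x y|[a b] [c d]//]; rewrite addr0. Qed.
Lemma re_partN x : re_part (- x) = - re_part x.
Proof. by case: k x => //= -[a b]. Qed.
Lemma im_partN x : im_part (- x) = - im_part x.
Proof. by case: k x => //= [x|[a b]//]; rewrite oppr0. Qed.
Lemma re_part0 : re_part (0 : F) = 0.
Proof. by case: k. Qed.
Lemma im_part0 : im_part (0 : F) = 0.
Proof. by case: k. Qed.
Lemma re_partM x y :
  re_part (x * y) = re_part x * re_part y - im_part x * im_part y.
Proof. by case: k x y => //= [x y|[a b] [c d]//]; rewrite mul0r subr0. Qed.
Lemma im_partM x y :
  im_part (x * y) = re_part x * im_part y + im_part x * re_part y.
Proof.
by case: k x y => //= [x y|[a b] [c d] //=]; rewrite mulr0 mul0r addr0.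
Qed.
Lemma re_conj x : re_part (conj_scalar x) = re_part x.
Proof. by case: k x => //= -[]. Qed.
Lemma im_conj x : im_part (conj_scalar x) = - im_part x.
Proof. by case: k x => //= [x|[]//]; rewrite oppr0. Qed.
Lemma re_of_real a : re_part (of_real k a) = a.
Proof. by rewrite /of_real; case: k. Qed.
Lemma im_of_real a : im_part (of_real k a) = 0.
Proof. by rewrite /of_real; case: k. Qed.
Lemma re_mk a b : re_part (mk_scalar k a b) = a.
Proof. by case: k. Qed.

End scalar_parts.

Definition scalar_partE := (@re_partD, @im_partD, @re_partN, @im_partN,
  @re_part0, @im_part0, @re_partM, @im_partM, @re_conj, @im_conj, @re_of_real,
  @im_of_real).

Section scalar_norms.
Context {R : realType} {k : scalars}.
Local Notation F := (scalar_field R k).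
Implicit Types (x y z : F) (a b : R).

Lemma of_real0 : of_real k (0 : R) = 0.
Proof. by apply: scalar_ext; rewrite !scalar_partE. Qed.
Lemma of_real1 : of_real k (1 : R) = 1.
Proof. by rewrite /of_real; case: k. Qed.
Lemma of_realD a b : of_real k (a + b) = of_real k a + of_real k b.
Proof. by apply: scalar_ext; rewrite !scalar_partE ?addr0. Qed.
Lemma of_realM a b : of_real k (a * b) = of_real k a * of_real k b.
Proof. by apply: scalar_ext; rewrite !scalar_partE; ring. Qed.
Lemma of_real_inj : injective (of_real k : R -> F).
Proof. by move=> a b /(congr1 (@re_part R k)); rewrite !scalar_partE. Qed.
Lemma ler_of_real a b : (of_real k a <= of_real k b) = (a <= b).
Proof. by rewrite /of_real; case: k => //=; rewrite lecR. Qed.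
Lemma ltr_of_real a b : (of_real k a < of_real k b) = (a < b).
Proof. by rewrite /of_real; case: k => //=; rewrite ltcR. Qed.

Lemma ge0_of_real x : 0 <= x -> x = of_real k (re_part x).
Proof.
rewrite /of_real; case: k x => //= -[a b] /=.
by rewrite lecE /= => /andP[/eqP -> _].
Qed.

Lemma scalar_normE z : `|z| = of_real k (scalar_abs z).
Proof. exact: ge0_of_real. Qed.

Lemma scalar_abs_sqr z : scalar_abs z ^+ 2 = re_part z ^+ 2 + im_part z ^+ 2.
Proof.
rewrite /scalar_abs; case: k z => /= [z|[a b]].
  by rewrite real_normK ?num_real// expr0n addr0.
by rewrite sqr_sqrtr // addr_ge0 // sqr_ge0.
Qed.

Lemma scalar_abs_ge0 z : 0 <= scalar_abs z.
Proof. by rewrite -ler_of_real -scalar_normE of_real0. Qed.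

Lemma scalar_absM x y : scalar_abs (x * y) = scalar_abs x * scalar_abs y.
Proof. by apply: of_real_inj; rewrite of_realM -!scalar_normE normrM. Qed.

Lemma scalar_abs_of_real a : 0 <= a -> scalar_abs (of_real k a) = a.
Proof.
move=> a0; apply: of_real_inj; rewrite -scalar_normE ger0_norm //.
by rewrite -of_real0 ler_of_real.
Qed.

Lemma mulr_conj z : z * conj_scalar z = of_real k (scalar_abs z ^+ 2).
Proof.
by rewrite scalar_abs_sqr; apply: scalar_ext; rewrite !scalar_partE; ring.
Qed.

Lemma conj_scalarK : involutive (@conj_scalar R k).
Proof. by move=> z; apply: scalar_ext; rewrite !scalar_partE ?opprK. Qed.

Lemma conj_scalarM x y : conj_scalar (x * y) = conj_scalar x * conj_scalar y.
Proof. by apply: scalar_ext; rewrite !scalar_partE; ring. Qed.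

Lemma conj_scalarD x y : conj_scalar (x + y) = conj_scalar x + conj_scalar y.
Proof. by apply: scalar_ext; rewrite !scalar_partE; ring. Qed.

Lemma conj_of_real a : conj_scalar (of_real k a) = of_real k a.
Proof. by apply: scalar_ext; rewrite !scalar_partE ?oppr0. Qed.

Lemma scalar_abs0_eq0 z : scalar_abs z = 0 -> z = 0.
Proof. by move=> z0; apply: normr0_eq0; rewrite scalar_normE z0 of_real0. Qed.

Section rnorm.
Variable V : normedModType F.
Implicit Types u v : V.

Lemma normE v : `|v| = of_real k (rnorm v).
Proof. exact: ge0_of_real. Qed.
Lemma rnorm_ge0 v : 0 <= rnorm v.
Proof. by rewrite -ler_of_real -normE of_real0. Qed.
Lemma rnorm0 : rnorm (0 : V) = 0.
Proof. by rewrite /rnorm normr0 re_part0. Qed.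
Lemma rnormN v : rnorm (- v) = rnorm v.
Proof. by rewrite /rnorm normrN. Qed.
Lemma rdistC u v : rnorm (u - v) = rnorm (v - u).
Proof. by rewrite /rnorm distrC. Qed.
Lemma rnorm_eq0 v : rnorm v = 0 -> v = 0.
Proof. by move=> v0; apply: normr0_eq0; rewrite normE v0 of_real0. Qed.
Lemma ler_rnormD u v : rnorm (u + v) <= rnorm u + rnorm v.
Proof. by rewrite -ler_of_real of_realD -!normE ler_normD. Qed.
Lemma rnormZ z v : rnorm (z *: v) = scalar_abs z * rnorm v.
Proof. by apply: of_real_inj; rewrite of_realM -scalar_normE -!normE normrZ. Qed.
Lemma ler_rnorm_sum (I : Type) (r : seq I) (Q : pred I) (G : I -> V) :
  rnorm (\sum_(i <- r | Q i) G i) <= \sum_(i <- r | Q i) rnorm (G i).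
Proof.
elim/big_ind2: _ => [|a x b y ax byy|//]; first by rewrite rnorm0.
by apply: le_trans (ler_rnormD _ _) _; exact: lerD.
Qed.

Lemma cvg_rnormP (u : nat -> V) (l : V) :
  u n @[n --> \oo] --> l <->
  forall e : R, 0 < e -> \forall n \near \oo, rnorm (l - u n) < e.
Proof.
split=> [/cvgrPdist_lt ul e e0|H].
  have /ul : 0 < of_real k e by rewrite -of_real0 ltr_of_real.
  by apply: filterS => n; rewrite normE ltr_of_real.
apply/cvgrPdist_lt => e e0.
have := ge0_of_real (ltW e0) => eE; move: e0.
rewrite eE -of_real0 ltr_of_real => /H.
by apply: filterS => n; rewrite normE ltr_of_real.
Qed.

End rnorm.

Lemma cauchy_rnorm_cvg (V : completeNormedModType F) (u : nat -> V) :
  (forall e : R, 0 < e -> exists N, forall m n, (N <= m)%N -> (N <= n)%N ->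
     rnorm (u m - u n) < e) ->
  exists l : V, u n @[n --> \oo] --> l.
Proof.
move=> H; exists (limn u).
apply: cauchy_cvg; apply: cauchy_exP => e e0.
have eE := ge0_of_real (ltW e0); move: e0.
rewrite eE -of_real0 ltr_of_real => /H[N HN].
exists (u N), N => // n /= Nn.
by rewrite -ball_normE /= normE ltr_of_real; apply: HN.
Qed.

End scalar_norms.

(** * Orthogonal projection in a Hilbert space *)

Section hilbert.
Context {R : realType} {k : scalars}.
Local Notation F := (scalar_field R k).
Variable V : completeNormedModType F.
Variable dot : {dot V for @conj_scalar R k}.
Hypothesis hV : hilbert_dot dot.
Implicit Types u v w : V.

Definition rdot u v : R := re_part (dot u v).

Lemma dotC u v : dot u v = conj_scalar (dot v u).
Proof. by rewrite hermitian_subproof expr0 mul1r. Qed.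

Lemma dotBl u v w : dot (u - v) w = dot u w - dot v w.
Proof. exact: zmod_morphisml_subproof. Qed.

Lemma dot0l w : dot 0 w = 0.
Proof. by rewrite -(subrr (0 : V)) dotBl subrr. Qed.

Lemma dotDl u v w : dot (u + v) w = dot u w + dot v w.
Proof. by rewrite -[v in LHS]opprK -[- v]sub0r !dotBl dot0l sub0r opprK. Qed.

Lemma dotZl a v w : dot (a *: v) w = a * dot v w.
Proof. exact: linearl_subproof. Qed.

Lemma dot_suml (I : Type) (r : seq I) (Q : pred I) (G : I -> V) w :
  dot (\sum_(i <- r | Q i) G i) w = \sum_(i <- r | Q i) dot (G i) w.
Proof.
elim/big_rec2: _ => [|i x y _ <-]; first exact: dot0l.
by rewrite dotDl.
Qed.

Lemma rdotC u v : rdot u v = rdot v u.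
Proof. by rewrite /rdot dotC re_conj. Qed.

Lemma rdotDl u v w : rdot (u + v) w = rdot u w + rdot v w.
Proof. by rewrite /rdot dotDl re_partD. Qed.

Lemma rdotZl a v w : rdot (of_real k a *: v) w = a * rdot v w.
Proof. by rewrite /rdot dotZl re_partM re_of_real im_of_real mul0r subr0. Qed.

Lemma rdotNl v w : rdot (- v) w = - rdot v w.
Proof. by rewrite -sub0r /rdot dotBl dot0l sub0r re_partN. Qed.

Lemma rdotDr u v w : rdot w (u + v) = rdot w u + rdot w v.
Proof. by rewrite rdotC rdotDl ![rdot _ w]rdotC. Qed.

Lemma rdotZr a v w : rdot w (of_real k a *: v) = a * rdot w v.
Proof. by rewrite rdotC rdotZl rdotC. Qed.

Lemma rdotNr v w : rdot w (- v) = - rdot w v.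
Proof. by rewrite rdotC rdotNl rdotC. Qed.

Lemma rdot_suml (I : Type) (r : seq I) (Q : pred I) (G : I -> V) w :
  rdot (\sum_(i <- r | Q i) G i) w = \sum_(i <- r | Q i) rdot (G i) w.
Proof.
by rewrite /rdot dot_suml; apply: (big_morph _ (@re_partD _ _) (@re_part0 _ _)).
Qed.

Definition rdotE := (rdotDl, rdotDr, rdotNl, rdotNr, rdotZl, rdotZr).

Lemma rdot_sqr v : rdot v v = rnorm v ^+ 2.
Proof.
by rewrite /rdot hV normE expr2 -of_realM re_of_real -expr2.
Qed.

Lemma rdot_le u v : rdot u v <= rnorm u * rnorm v.
Proof.
have [v0|v0] := eqVneq (rnorm v) 0.
  by rewrite (rnorm_eq0 v0) rnorm0 mulr0 rdotC /rdot dot0l re_part0.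
have vp : 0 < rnorm v by rewrite lt0r v0 rnorm_ge0.
pose t := rnorm u / rnorm v.
have [u0|u0] := eqVneq (rnorm u) 0.
  by rewrite (rnorm_eq0 u0) rnorm0 mul0r /rdot dot0l re_part0.
have up : 0 < rnorm u by rewrite lt0r u0 rnorm_ge0.
have := sqr_ge0 (rnorm (of_real k (rnorm v) *: u - of_real k (rnorm u) *: v)).
rewrite -rdot_sqr !rdotE [rdot v u]rdotC !rdot_sqr => H.
rewrite -(@ler_pM2l _ (rnorm u * rnorm v)) ?mulr_gt0//; nra.
Qed.

Lemma ler_abs_rdot u v : `|rdot u v| <= rnorm u * rnorm v.
Proof.
by rewrite ler_norml rdot_le lerNl -rdotNl -[rnorm u]rnormN rdot_le.
Qed.

(** Minimising the distance from y to W: the parallelogram law makes a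
    minimising sequence Cauchy, and its limit is the orthogonal projection of y
    onto the closure of W. *)
Lemma hilbert_projection (W : set V) (y : V) :
  W 0 -> (forall a u v, W u -> W v -> W (a *: u + v)) ->
  exists2 z : V, forall w, W w -> rdot (y - z) w = 0 &
    forall e : R, 0 < e -> exists2 w, W w & rnorm (z - w) < e.
Proof.
move=> W0 WL.
pose q w := rnorm (y - w) ^+ 2.
pose m := inf [set q w | w in W].
have qm w : W w -> m <= q w.
  move=> Ww; apply: ge_inf; last by exists w.
  by exists 0 => _ [v _ <-]; exact: sqr_ge0.
have appr (n : nat) : exists w, W w /\ q w < m + n.+1%:R^-1.
  have [_ [w Ww <-] qw] : exists2 x, [set q w | w in W] x & x < m + n.+1%:R^-1.
    apply: inf_adherent; first by rewrite invr_gt0.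
    split; first by exists (q 0), 0.
    by exists 0 => _ [v _ <-]; exact: sqr_ge0.
  by exists w.
have [w_ Hw] := choice appr.
have par i j : rnorm (w_ i - w_ j) ^+ 2 <= 2 * i.+1%:R^-1 + 2 * j.+1%:R^-1.
  have [Wi qi] := Hw i; have [Wj qj] := Hw j.
  have Wm : W (of_real k 2^-1 *: (w_ i + w_ j)).
    rewrite -[X in W X]addr0; apply: (WL _ _ _ _ W0).
    by rewrite -[w_ i]scale1r; exact: WL.
  have := qm _ Wm; move: qi qj; rewrite /q.
  rewrite -!rdot_sqr !rdotE [rdot (w_ j) (w_ i)]rdotC [rdot (w_ i) y]rdotC
    [rdot (w_ j) y]rdotC.
  move: i.+1%:R^-1 j.+1%:R^-1 => a b; lra.
have small (e : R) : 0 < e -> exists N, forall n, (N <= n)%N -> n.+1%:R^-1 < e.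
  move=> e0; have [N _ HN] := near_infty_natSinv_lt (PosNum e0).
  by exists N => n Nn; exact: HN.
have [z wz] : exists z : V, w_ n @[n --> \oo] --> z.
  apply: cauchy_rnorm_cvg => e e0.
  have [N HN] := small (e ^+ 2 / 4) ltac:(by rewrite divr_gt0 ?exprn_gt0).
  exists N => i j /HN Ni /HN Nj.
  rewrite -(@ltr_pXn2r _ 2) ?nnegrE ?rnorm_ge0 ?ltW//.
  have := par i j; move: Ni Nj; move: i.+1%:R^-1 j.+1%:R^-1 => a b; lra.
move/cvg_rnormP in wz.
exists z; last first.
  move=> e /wz[N _ HN]; exists (w_ N); first exact: (Hw N).1.
  exact: HN (leqnn N).
have le0 w : W w -> rdot (y - z) w <= 0.
  move=> Ww; apply/ler_addgt0Pr => e e0; rewrite add0r.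
  pose B := rnorm w ^+ 2 + 1.
  have B0 : 0 < B by rewrite /B ltr_wpDl ?sqr_ge0.
  pose t := e / B; have t0 : 0 < t by rewrite divr_gt0.
  have [N1 HN1] := small (t * e / 2)
    ltac:(by apply: divr_gt0 => //; apply: mulr_gt0).
  have [N2 _ HN2] := wz (e / 4 / (rnorm w + 1))
    ltac:(by apply: divr_gt0; [exact: divr_gt0|rewrite ltr_wpDl ?rnorm_ge0]).
  pose n := maxn N1 N2.
  have hn1 := HN1 n (leq_maxl _ _); have hn2 := HN2 n (leq_maxr _ _).
  have [Wn qn] := Hw n.
  have Wnt : W (of_real k t *: w + w_ n) by exact: WL.
  have h1 := qm _ Wnt.
  have h2 : 2 * t * rdot (y - w_ n) w <= n.+1%:R^-1 + t ^+ 2 * rnorm w ^+ 2.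
    move: h1 qn; move: n.+1%:R^-1 => a.
    rewrite /q -!rdot_sqr !rdotE [rdot w (w_ n)]rdotC
     [rdot (w_ n) y]rdotC [rdot w y]rdotC; lra.
  have h3 : rdot (y - z) w <= rdot (y - w_ n) w + e / 4.
    have -> : y - z = (y - w_ n) + (w_ n - z) by rewrite addrA subrK.
    rewrite rdotDl lerD2l (le_trans (rdot_le _ _)) // rdistC.
    have w1 : 0 < rnorm w + 1 by rewrite ltr_wpDl ?rnorm_ge0.
    move: hn2; rewrite /= ltr_pdivlMr // => hn2.
    have := rnorm_ge0 (z - w_ n); have := rnorm_ge0 w; nra.
  have h4 : t * rnorm w ^+ 2 <= e.
    rewrite /t mulrAC ler_pdivrMr // ler_pM2l // /B; lra.
  have : 2 * rdot (y - w_ n) w <= e / 2 + e.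
    rewrite -(@ler_pM2l _ t) // mulrA [t * 2]mulrC.
    have : t * (t * rnorm w ^+ 2) <= t * e by rewrite ler_pM2l.
    move: hn1 h2; move: n.+1%:R^-1 => a; rewrite mulrA -expr2; lra.
  lra.
move=> w Ww; apply/eqP; rewrite eq_le le0 //=.
have : W (of_real k (-1) *: w) by rewrite -[X in W X]addr0; exact: WL.
by move=> /le0; rewrite rdotZr mulN1r oppr_le0.
Qed.

Lemma hilbert_dense (W : set V) :
  W 0 -> (forall a u v, W u -> W v -> W (a *: u + v)) ->
  (forall y, (forall w, W w -> dot w y = 0) -> y = 0) ->
  forall (y : V) (e : R), 0 < e -> exists2 w, W w & rnorm (y - w) < e.
Proof.
move=> W0 WL orth y e e0.
have [z zorth zlim] := hilbert_projection y W0 WL.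
suff -> : y = z by exact: zlim.
apply/eqP; rewrite -subr_eq0; apply/eqP/orth => w Ww.
apply: scalar_abs0_eq0; apply/eqP; rewrite -sqrf_eq0; apply/eqP.
set a := dot w (y - z).
(* the scalar conj a turns the vanishing of real parts into that of dot *)
have : W (conj_scalar a *: w) by rewrite -[X in W X]addr0; exact: WL.
move=> /zorth; rewrite rdotC /rdot dotZl -/a mulrC mulr_conj re_of_real.
by [].
Qed.

End hilbert.

(** * Mean-square completeness *)

Section realL2.
Context {d : measure_display} {T : measurableType d} {R : realType}.
Variables (mu : {measure set T -> \bar R}) (D : set T).
Hypothesis mD : measurable D.
Implicit Types u v : T -> R.

Definition sqr_integrable u : Prop :=
  measurable_fun D u /\ (\int[mu]_(t in D) (u t ^+ 2)%:E < +oo)%E.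

Lemma measurable_EFin_sqr u :
  measurable_fun D u -> measurable_fun D (fun t => (u t ^+ 2)%:E).
Proof. by move=> mu_; apply/measurable_EFinP; exact: measurable_funX. Qed.

Lemma sqr_integrable_integrable u :
  sqr_integrable u -> mu.-integrable D (EFin \o (fun t => u t ^+ 2)).
Proof.
move=> [mu_ fu]; apply/integrableP; split; first exact: measurable_EFin_sqr.
rewrite (eq_integral (fun t => (u t ^+ 2)%:E)) // => t _.
by rewrite gee0_abs // lee_fin sqr_ge0.
Qed.

Lemma sqr_integrableM u v : sqr_integrable u -> sqr_integrable v ->
  mu.-integrable D (EFin \o (fun t => u t * v t)).
Proof.
move=> hu hv; have [mu_ _] := hu; have [mv _] := hv.
apply: (@le_integrable _ _ _ mu _ mD _ (EFin \o (fun t => u t ^+ 2 + v t ^+ 2))).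
- by apply/measurable_EFinP; exact: measurable_funM.
- move=> t _ /=; rewrite lee_fin.
  rewrite [leRHS]ger0_norm ?addr_ge0 ?sqr_ge0 // ler_norml; apply/andP; split.
    by have := sqr_ge0 (u t + v t); have := sqr_ge0 (u t);
       have := sqr_ge0 (v t); nra.
  by have := sqr_ge0 (u t - v t); have := sqr_ge0 (u t);
     have := sqr_ge0 (v t); nra.
- by apply: (@integrableD _ _ _ mu _ mD (EFin \o (fun t => u t ^+ 2))
    (EFin \o (fun t => v t ^+ 2))); exact: sqr_integrable_integrable.
Qed.

Lemma integral_sqrD_le u v : measurable_fun D u -> measurable_fun D v ->
  (\int[mu]_(t in D) ((u t + v t) ^+ 2)%:E <=
   2%:E * \int[mu]_(t in D) (u t ^+ 2)%:E +
   2%:E * \int[mu]_(t in D) (v t ^+ 2)%:E)%E.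
Proof.
move=> mu_ mv.
have pos (w : T -> R) t : D t -> (0 <= (w t ^+ 2)%:E)%E.
  by move=> _; rewrite lee_fin sqr_ge0.
rewrite -!ge0_integralZl //; try exact: measurable_EFin_sqr; try exact: pos.
rewrite -ge0_integralD //; last 4 first.
- by move=> t _; rewrite -EFinM lee_fin mulr_ge0 ?sqr_ge0.
- by apply: emeasurable_funM => //; exact: measurable_EFin_sqr.
- by move=> t _; rewrite -EFinM lee_fin mulr_ge0 ?sqr_ge0.
- by apply: emeasurable_funM => //; exact: measurable_EFin_sqr.
apply: ge0_le_integral => //.
- by move=> t _; rewrite lee_fin sqr_ge0.
- by apply: measurable_EFin_sqr; exact: measurable_funD.
- by apply: emeasurable_funD; apply: emeasurable_funM => //;
    exact: measurable_EFin_sqr.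
- move=> t _; rewrite -!EFinM -EFinD lee_fin.
  by have := sqr_ge0 (u t - v t); nra.
Qed.

Lemma sqr_integrableD u v : sqr_integrable u -> sqr_integrable v ->
  sqr_integrable (fun t => u t + v t).
Proof.
move=> [mu_ fu] [mv fv]; split; first exact: measurable_funD.
apply: le_lt_trans (integral_sqrD_le mu_ mv) _.
by apply: lte_add_pinfty; apply: lte_mul_pinfty => //; rewrite lee_fin.
Qed.

Lemma sqr_integrableZ (a : R) u :
  sqr_integrable u -> sqr_integrable (fun t => a * u t).
Proof.
move=> [mu_ fu]; split; first exact: measurable_funM.
under eq_integral do rewrite exprMn EFinM.
rewrite ge0_integralZl //; last 3 first.
- exact: measurable_EFin_sqr.
- by move=> t _; rewrite lee_fin sqr_ge0.
- by rewrite lee_fin sqr_ge0.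
by apply: lte_mul_pinfty => //; rewrite lee_fin sqr_ge0.
Qed.

Lemma sqr_integrable0 : sqr_integrable (fun=> 0).
Proof.
split; first exact: measurable_cst.
by under eq_integral do rewrite expr0n; rewrite integral0.
Qed.

Definition pairing u v : R := \int[mu]_(t in D) (u t * v t).

Lemma pairingC u v : pairing u v = pairing v u.
Proof. by rewrite /pairing; under eq_Rintegral do rewrite mulrC. Qed.

Lemma pairing_lin (a b : R) u v w :
  sqr_integrable u -> sqr_integrable v -> sqr_integrable w ->
  pairing (fun t => a * u t + b * v t) w = a * pairing u w + b * pairing v w.
Proof.
move=> hu hv hw; rewrite /pairing.
have iu := sqr_integrableM hu hw; have iv := sqr_integrableM hv hw.
rewrite -!RintegralZl // -RintegralD //; last 2 first.
- exact: (integrableZl mD a iu).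
- exact: (integrableZl mD b iv).
by apply: eq_Rintegral => t _; ring.
Qed.

Lemma pairingDl u v w :
  sqr_integrable u -> sqr_integrable v -> sqr_integrable w ->
  pairing (fun t => u t + v t) w = pairing u w + pairing v w.
Proof.
move=> hu hv hw; have := pairing_lin 1 1 hu hv hw.
rewrite !mul1r => <-; rewrite /pairing; apply: eq_Rintegral => t _.
by rewrite !mul1r.
Qed.

Lemma pairing_sqr u : sqr_integrable u ->
  (pairing u u)%:E = (\int[mu]_(t in D) (u t ^+ 2)%:E)%E.
Proof.
move=> [mu_ fu]; rewrite /pairing /Rintegral fineK.
  by apply: eq_integral => t _; rewrite expr2.
under eq_integral do rewrite -expr2.
rewrite ge0_fin_numE //.
by apply: integral_ge0 => t _; rewrite lee_fin sqr_ge0.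
Qed.

Lemma sum_half_le n : \sum_(0 <= i < n) 2^-1 ^+ i <= 2 :> R.
Proof.
suff -> : \sum_(0 <= i < n) 2^-1 ^+ i = 2 - 2 * 2^-1 ^+ n :> R.
  by rewrite lerBlDr lerDl mulr_ge0 // exprn_ge0 // invr_ge0.
elim: n => [|n IH]; first by rewrite big_nil expr0 mulr1 subrr.
by rewrite big_nat_recr //= IH exprS; field.
Qed.

(** Pointwise, |d_k| <= 2^-k + 2^k d_k^2; the sum of the last terms has a
    finite integral, hence is finite almost everywhere. *)
Lemma ae_cvg_series_of_fast (g : nat -> T -> R) :
  (forall n, measurable_fun D (g n)) ->
  (forall n, (\int[mu]_(t in D) (g n t ^+ 2)%:E <= (2^-1 ^+ n ^+ 2)%:E)%E) ->
  {ae mu, forall t, D t -> cvgn (series (fun n => g n t))}.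
Proof.
move=> mg gle.
pose h n t := (2 ^+ n * g n t ^+ 2)%:E.
have mh n : measurable_fun D (h n).
  apply/measurable_EFinP; apply: measurable_funM => //.
  exact: measurable_funX.
have h0 n t : D t -> (0 <= h n t)%E.
  by move=> _; rewrite /h lee_fin mulr_ge0 ?sqr_ge0 ?exprn_ge0.
have hfin : (\int[mu]_(t in D) \sum_(0 <= n <oo) h n t < +oo)%E.
  rewrite integral_nneseries //.
  apply: (@le_lt_trans _ _ (\sum_(0 <= n <oo) (2^-1 ^+ n)%:E)%E).
    apply: lee_nneseries => [n _ _|n _].
      by apply: integral_ge0 => t Dt; exact: h0.
    rewrite /h; under eq_integral do rewrite EFinM.
    rewrite ge0_integralZl //; first last.
    - by move=> t _; rewrite lee_fin sqr_ge0.
    - exact: measurable_EFin_sqr.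
    apply: (@le_trans _ _ ((2 ^+ n)%:E * (2^-1 ^+ n ^+ 2)%:E)%E).
      by apply: lee_wpmul2l => //; rewrite lee_fin exprn_ge0.
    by rewrite -EFinM lee_fin expr2 mulrA -exprMn mulfV ?pnatr_eq0 // expr1n mul1r.
  apply: (@le_lt_trans _ _ ((2 : R)%:E)); last exact: ltry.
  apply: lime_le; first apply: is_cvg_nneseries => n _ _.
    by rewrite lee_fin exprn_ge0 ?invr_ge0.
  by apply: nearW => n; rewrite sumEFin lee_fin sum_half_le.
have hint : mu.-integrable D (fun t => \sum_(0 <= n <oo) h n t)%E.
  apply/integrableP; split.
    by apply: (@ge0_emeasurable_sum _ _ _ _ h xpredT) => // n t Dt _; exact: h0.
  rewrite (eq_integral (fun t => \sum_(0 <= n <oo) h n t)%E) // => t /set_mem Dt.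
  by rewrite gee0_abs // nneseries_ge0 // => n _ _; exact: h0.
apply: filterS (integrable_ae mD hint) => t + Dt => /(_ Dt) fint.
apply: normed_cvg.
apply: nondecreasing_is_cvgn.
  by apply: nondecreasing_series => n _ _; exact: normr_ge0.
exists (2 + fine (\sum_(0 <= n <oo) h n t)%E) => _ [N _ <-].
rewrite /series /=.
apply: (@le_trans _ _ (\sum_(0 <= i < N) (2^-1 ^+ i + 2 ^+ i * g i t ^+ 2))).
  apply: ler_sum => i _.
  have p0 : 0 < (2 : R) ^+ i by rewrite exprn_gt0.
  rewrite exprVn -(@ler_pM2l _ (2 ^+ i)) // mulrDr mulfV ?gt_eqF //.
  have := sqr_ge0 (2 ^+ i * `|g i t| - 1).
  rewrite -[g i t ^+ 2]real_normK ?num_real //.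
  have : 0 <= 2 ^+ i * `|g i t| by rewrite mulr_ge0 // ltW.
  nra.
rewrite big_split /=; apply: lerD; first exact: sum_half_le.
rewrite -lee_fin fineK // -sumEFin.
by apply: nneseries_lim_ge => n _ _; exact: h0.
Qed.

(** Riesz-Fischer.  Along a fast subsequence the increments satisfy
    |d_k| <= 2^-k + 2^k d_k^2, and the right-hand side has a finite sum almost
    everywhere because its second part has a finite integral; hence the
    subsequence converges almost everywhere, and Fatou's lemma turns this into
    convergence in mean square of the whole sequence. *)
Lemma riesz_fischer (u : nat -> T -> R) :
  (forall n, measurable_fun D (u n)) ->
  (forall e : R, 0 < e -> exists N, forall m n, (N <= m)%N -> (N <= n)%N ->
     (\int[mu]_(t in D) ((u m t - u n t) ^+ 2)%:E <= e%:E)%E) ->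
  exists2 v : T -> R, measurable_fun D v &
    forall e : R, 0 < e -> exists N, forall n, (N <= n)%N ->
     (\int[mu]_(t in D) ((v t - u n t) ^+ 2)%:E <= e%:E)%E.
Proof.
move=> mU cu.
have [N_ HN] := choice (fun k => cu (2^-1 ^+ k ^+ 2)
  ltac:(by rewrite !exprn_gt0 // invr_gt0)).
(* strictly increasing indices beyond the thresholds N_ 0, ..., N_ k *)
pose s k := (\sum_(i < k.+1) (N_ i).+1)%N.
have sN k : (N_ k <= s k)%N.
  by rewrite /s big_ord_recr /= ltnW // leq_addl.
have sS k : (s k < s k.+1)%N.
  by rewrite /s [leqRHS]big_ord_recr /= -addn1 leq_add2l.
have sk k : (k <= s k)%N by elim: k => // k IH; exact: leq_ltn_trans (sS k).
pose g k t := u (s k.+1) t - u (s k) t.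
have := @ae_cvg_series_of_fast g
  (fun n => measurable_funB (mU _) (mU _))
  (fun n => HN n _ _ (leq_trans (sN n) (ltnW (sS n))) (sN n)).
move=> aeg.
have {}aeg : {ae mu, forall t, D t -> cvgn (fun k => u (s k) t)}.
  apply: filterS aeg => t cg Dt; have := cg Dt.
  rewrite (_ : series _ = fun K => u (s K) t - u (s 0) t); last first.
    by apply/funext => K; rewrite /series /= telescope_sumr.
  move=> c; rewrite (_ : (fun K => u (s K) t) =
    (fun K => (u (s K) t - u (s 0) t) + u (s 0) t)).
    by apply: is_cvgD => //; exact: is_cvg_cst.
  by apply/funext => K; rewrite subrK.
pose v t := fine (limn_esup (fun k => (u (s k) t)%:E)).
have mv : measurable_fun D v.
  apply: (measurableT_comp (fine_measurable measurableT)).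
  by apply: measurable_fun_limn_esup => n; apply/measurable_EFinP.
exists v => // e e0; have [N HNe] := cu e e0.
exists N => n Nn.
pose f k t := ((u (s k) t - u n t) ^+ 2)%:E.
have mf k : measurable_fun D (f k).
  by apply: measurable_EFin_sqr; exact: measurable_funB.
have f0 k t : D t -> (0 <= f k t)%E by move=> _; rewrite /f lee_fin sqr_ge0.
apply: (@le_trans _ _ (\int[mu]_(t in D) limn_einf (f^~ t))%E).
  apply: ae_ge0_le_integral => //.
  - by move=> t _; rewrite lee_fin sqr_ge0.
  - by apply: measurable_EFin_sqr; exact: measurable_funB.
  - move=> t Dt; rewrite limn_einf_lim; apply: lime_ge; first exact: is_cvg_einfs.
    by apply: nearW => K; apply/ereal_infP => _ [i _ <-]; exact: f0.
  - apply: measurableT_comp; first exact: oppe_measurable.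
    by apply: measurable_fun_limn_esup => i; apply: measurableT_comp.
  apply: filterS aeg => t c Dt; have {}c := c Dt.
  have vE : v t = limn (fun k => u (s k) t).
    rewrite /v (@is_cvg_limn_esupE _ (fun k => (u (s k) t)%:E)).
      by rewrite EFin_lim.
    apply/cvg_ex; exists (limn (fun k => u (s k) t))%:E.
    by apply: cvg_EFin => //; exact: nearW.
  suff /cvg_limn_einf_sup[-> _] : 
    f k t @[k --> \oo] --> ((v t - u n t) ^+ 2)%:E by exact: lexx.
  have sq : (u (s k) t - u n t) * (u (s k) t - u n t) @[k --> \oo] -->
      (v t - u n t) * (v t - u n t).
    by apply: cvgM; rewrite vE; apply: cvgB => //; exact: cvg_cst.
  apply: cvg_EFin; first exact: nearW.
  rewrite expr2; apply: cvg_trans sq; apply: near_eq_cvg; apply: nearW => i.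
  by rewrite /= expr2.
apply: le_trans (fatou mu mD mf f0) _.
rewrite limn_einf_lim; apply: lime_le; first exact: is_cvg_einfs.
apply: nearW => K; apply: ge_ereal_inf.
exists (\int[mu]_(t in D) f (maxn K N) t)%E.
  by exists (maxn K N) => //=; rewrite leq_maxl.
apply: HNe => //; apply: leq_trans (sk _); exact: leq_maxr.
Qed.

End realL2.

(** * Measurability of open sets of R^n *)

Section open_measurable.
Context {R : realType} {n : nat}.

(** Every point of an open set lies in a box with rational corners contained
    in it, and there are only countably many such boxes. *)
Lemma open_Rn_measurable (Omega : set (Rn R n)) :
  open_Rn Omega -> measurable Omega.
Proof.
move=> oO.
pose box (p : {ffun 'I_n -> rat} * {ffun 'I_n -> rat}) : set (Rn R n) :=
  [set x | forall i, [set` `](ratr (p.1 i)), (ratr (p.2 i))[%R] (tnth x i)].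
have -> : Omega = \bigcup_(p in [set p | box p `<=` Omega]) box p.
  apply/seteqP; split=> [x Ox|x [p /= pO px]]; last exact: pO.
  pose y : 'rV[R]_n := \row_i tnth x i.
  have tupE (z : Rn R n) : [tuple (\row_j tnth z j : 'rV[R]_n) ord0 i | i < n] = z.
    by apply: eq_from_tnth => i; rewrite tnth_mktuple mxE.
  have Oy : [set x : 'rV[R]_n | Omega [tuple x ord0 i | i < n]] y.
    by rewrite /= /y tupE.
  have /nbhs_ballP[e /= e0 He] := open_nbhs_nbhs (conj oO Oy).
  have lo i : exists q : rat, tnth x i - e < ratr q < tnth x i.
    have [q] := @rat_in_itvoo R (tnth x i - e) (tnth x i)
      ltac:(by rewrite ltrBlDr ltrDl).
    by rewrite in_itv /= => ?; exists q.
  have hi i : exists q : rat, tnth x i < ratr q < tnth x i + e.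
    have [q] := @rat_in_itvoo R (tnth x i) (tnth x i + e)
      ltac:(by rewrite ltrDl).
    by rewrite in_itv /= => ?; exists q.
  have [a Ha] := choice lo; have [b Hb] := choice hi.
  exists ([ffun i => a i], [ffun i => b i]); last first.
    move=> i /=; rewrite in_itv /= !ffunE.
    by have /andP[_ ->] := Ha i; have /andP[-> _] := Hb i.
  move=> z /= zb; rewrite -(tupE z); apply: He.
  split=> // i j; rewrite !mxE /ball /=.
  have := zb j; rewrite /= in_itv /= !ffunE => /andP[az zb'].
  have /andP[? _] := Ha j; have /andP[_ ?] := Hb j.
  by rewrite ltr_distlC; apply/andP; split; lra.
rewrite bigcup_mkcond; apply: countable_bigcupT_measurable => [|p].
  exact: countableP.
case: ifP => _; last exact: measurable0.
apply: (@measurable_box_Rn R n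
  (fun i => [set` `](ratr (p.1 i)), (ratr (p.2 i))[%R])) => i.
exact: measurable_itv.
Qed.

End open_measurable.

(** * Square integrable scalar functions *)

Section scalarL2.
Context {d : measure_display} {T : measurableType d} {R : realType}.
Context {k : scalars}.
Variables (mu : {measure set T -> \bar R}) (D : set T).
Hypothesis mD : measurable D.
Local Notation F := (scalar_field R k).
Implicit Types u v : T -> F.

Let re u t : R := re_part (u t).
Let im u t : R := im_part (u t).

Lemma integral_scalar_abs_sqr u :
  measurable_fun D (re u) -> measurable_fun D (im u) ->
  (\int[mu]_(t in D) (scalar_abs (u t) ^+ 2)%:E =
   \int[mu]_(t in D) (re u t ^+ 2)%:E + \int[mu]_(t in D) (im u t ^+ 2)%:E)%E.
Proof.
move=> mr mi.
under eq_integral do rewrite scalar_abs_sqr EFinD.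
rewrite ge0_integralD //; try exact: measurable_EFin_sqr;
  by move=> t _; rewrite lee_fin sqr_ge0.
Qed.

Lemma scalar_L2P u : scalar_L2 mu D u <->
  sqr_integrable mu D (re u) /\ sqr_integrable mu D (im u).
Proof.
have pos (w : T -> R) : (0 <= \int[mu]_(t in D) (w t ^+ 2)%:E)%E.
  by apply: integral_ge0 => t _; rewrite lee_fin sqr_ge0.
split=> [[mr mi]|[[mr fr] [mi fi]]].
  rewrite integral_scalar_abs_sqr // => fin; split; split=> //;
    apply: le_lt_trans fin.
    exact: leeDl.
  exact: leeDr.
by split=> //; rewrite integral_scalar_abs_sqr //; exact: lte_add_pinfty.
Qed.

Lemma scalar_L2_0 : scalar_L2 mu D (fun=> 0 : F).
Proof.
have z := @sqr_integrable0 _ _ _ mu D.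
by apply/scalar_L2P; rewrite /re /im re_part0 im_part0.
Qed.

Lemma scalar_L2_lin (a : F) u v : scalar_L2 mu D u -> scalar_L2 mu D v ->
  scalar_L2 mu D (fun t => a * u t + v t).
Proof.
move=> /scalar_L2P[ru iu] /scalar_L2P[rv iv]; apply/scalar_L2P; split.
- rewrite [X in sqr_integrable _ _ X](_ : _ = fun t => (re_part a * re u t +
      (- im_part a) * im u t) + re v t).
    by do !apply: sqr_integrableD => //; exact: sqr_integrableZ.
  by apply/funext => t; rewrite /re !scalar_partE /im; ring.
- rewrite [X in sqr_integrable _ _ X](_ : _ = fun t => (re_part a * im u t +
      im_part a * re u t) + im v t).
    by do !apply: sqr_integrableD => //; exact: sqr_integrableZ.
  by apply/funext => t; rewrite /im !scalar_partE /re; ring.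
Qed.

Definition L2_dot u v : F :=
  scalar_integral mu D (fun t => u t * conj_scalar (v t)).

Let p := pairing mu D.

Lemma L2_dot_re u v : scalar_L2 mu D u -> scalar_L2 mu D v ->
  re_part (L2_dot u v) = p (re u) (re v) + p (im u) (im v).
Proof.
move=> /scalar_L2P[ru iu] /scalar_L2P[rv iv].
rewrite /L2_dot /scalar_integral re_mk /p /pairing -RintegralD //;
  try exact: sqr_integrableM.
by apply: eq_Rintegral => t _; rewrite !scalar_partE /re /im; ring.
Qed.

Lemma L2_dot_im u v : scalar_L2 mu D u -> scalar_L2 mu D v ->
  im_part (L2_dot u v) = p (im u) (re v) - p (re u) (im v).
Proof.
move=> /scalar_L2P[ru iu] /scalar_L2P[rv iv].
rewrite /p /pairing -RintegralB //; try exact: sqr_integrableM.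
rewrite (_ : im_part _ =
    \int[mu]_(t in D) im_part (u t * conj_scalar (v t))).
  by apply: eq_Rintegral => t _; rewrite !scalar_partE /re /im; ring.
rewrite /L2_dot /scalar_integral; case: k u v {ru iu rv iv} => //= u v.
under eq_Rintegral do rewrite -[0](mul0r (0 : R)).
by rewrite /Rintegral; under eq_integral do rewrite mul0r; rewrite integral0.
Qed.

Lemma L2_dot_linl (a : F) u v w :
  scalar_L2 mu D u -> scalar_L2 mu D v -> scalar_L2 mu D w ->
  L2_dot (fun t => a * u t + v t) w = a * L2_dot u w + L2_dot v w.
Proof.
move=> hu hv hw; have hc := scalar_L2_lin a hu hv.
have /scalar_L2P[ru iu] := hu; have /scalar_L2P[rv iv] := hv.
have /scalar_L2P[rw iw] := hw.
have Ere s : sqr_integrable mu D s ->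
    p (re (fun t => a * u t + v t)) s =
    re_part a * p (re u) s - im_part a * p (im u) s + p (re v) s.
  move=> hs.
  transitivity (p (fun t => (re_part a * re u t + (- im_part a) * im u t) +
      re v t) s).
    congr p; apply/funext => t; rewrite /re !scalar_partE /im; ring.
  rewrite /p pairingDl //; last first.
    by apply: sqr_integrableD => //; exact: sqr_integrableZ.
  by rewrite pairing_lin // mulNr.
have Eim s : sqr_integrable mu D s ->
    p (im (fun t => a * u t + v t)) s =
    re_part a * p (im u) s + im_part a * p (re u) s + p (im v) s.
  move=> hs.
  transitivity (p (fun t => (re_part a * im u t + im_part a * re u t) +
      im v t) s).
    congr p; apply/funext => t; rewrite /im !scalar_partE /re; ring.
  rewrite /p pairingDl //; last first.
    by apply: sqr_integrableD => //; exact: sqr_integrableZ.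
  by rewrite pairing_lin.
apply: scalar_ext; rewrite !scalar_partE ?L2_dot_re ?L2_dot_im //;
  rewrite !Ere // !Eim //; ring.
Qed.

Lemma L2_dotC u v : scalar_L2 mu D u -> scalar_L2 mu D v ->
  L2_dot u v = conj_scalar (L2_dot v u).
Proof.
move=> hu hv; apply: scalar_ext; rewrite !scalar_partE ?L2_dot_re ?L2_dot_im //.
  by rewrite /p [pairing _ _ (re v) _]pairingC [pairing _ _ (im v) _]pairingC.
by rewrite /p [pairing _ _ (re v) _]pairingC [pairing _ _ (im v) _]pairingC opprB.
Qed.

Lemma L2_dot_sqr u : scalar_L2 mu D u ->
  (re_part (L2_dot u u))%:E = (\int[mu]_(t in D) (scalar_abs (u t) ^+ 2)%:E)%E.
Proof.
move=> hu; have [mr mi _] := hu; have /scalar_L2P[ru iu] := hu.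
by rewrite L2_dot_re // EFinD !pairing_sqr // integral_scalar_abs_sqr.
Qed.

Lemma scalar_L2_complete (u : nat -> T -> F) :
  (forall n, scalar_L2 mu D (u n)) ->
  (forall e : R, 0 < e -> exists N, forall m n, (N <= m)%N -> (N <= n)%N ->
     (\int[mu]_(t in D) (scalar_abs (u m t - u n t) ^+ 2)%:E <= e%:E)%E) ->
  exists2 v, scalar_L2 mu D v &
    forall e : R, 0 < e -> exists N, forall n, (N <= n)%N ->
     (\int[mu]_(t in D) (scalar_abs (v t - u n t) ^+ 2)%:E <= e%:E)%E.
Proof.
move=> hu cu.
have mr n : measurable_fun D (re (u n)) by case: (hu n).
have mi n : measurable_fun D (im (u n)) by case: (hu n).
have pos (w : T -> R) : (0 <= \int[mu]_(t in D) (w t ^+ 2)%:E)%E.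
  by apply: integral_ge0 => t _; rewrite lee_fin sqr_ge0.
have splitE v n : measurable_fun D (re v) -> measurable_fun D (im v) ->
   (\int[mu]_(t in D) (scalar_abs (v t - u n t) ^+ 2)%:E =
    \int[mu]_(t in D) ((re v t - re (u n) t) ^+ 2)%:E +
    \int[mu]_(t in D) ((im v t - im (u n) t) ^+ 2)%:E)%E.
  move=> mrv miv; rewrite integral_scalar_abs_sqr /re /im.
  - by congr (_ + _)%E; apply: eq_integral => t _; rewrite !scalar_partE.
  - under eq_fun do rewrite !scalar_partE.
    exact: (measurable_funB mrv (mr n)).
  - under eq_fun do rewrite !scalar_partE.
    exact: (measurable_funB miv (mi n)).
have [r mr' rlim] := @riesz_fischer _ _ _ mu _ mD (fun n => re (u n)) mr
  ltac:(by move=> e /cu[N HN]; exists N => m n Nm Nn;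
    apply: le_trans (HN m n Nm Nn); rewrite splitE //; exact: leeDl).
(* over the reals the imaginary part of a scalar is 0, whatever the limit *)
have [i [mi' ilim iE]] : exists i : T -> R, [/\ measurable_fun D i,
    forall e : R, 0 < e -> exists N, forall n, (N <= n)%N ->
     (\int[mu]_(t in D) ((i t - im (u n) t) ^+ 2)%:E <= e%:E)%E &
    forall a t, im_part (mk_scalar k a (i t)) = i t].
  have [i mi' ilim] := @riesz_fischer _ _ _ mu _ mD (fun n => im (u n)) mi
    ltac:(by move=> e /cu[N HN]; exists N => m n Nm Nn;
      apply: le_trans (HN m n Nm Nn); rewrite splitE //; exact: leeDr).
  move: ilim; rewrite /im; case: k (u) => /= w ilim; last by exists i.
  exists (fun=> 0); split=> // e e0; exists 0%N => n _.
  by under eq_integral do rewrite subrr expr0n; rewrite integral0 lee_fin ltW.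
pose v t : F := mk_scalar k (r t) (i t).
have rv : re v = r by apply/funext => t; rewrite /re /v re_mk.
have iv : im v = i by apply/funext => t; rewrite /im /v iE.
have fin (s : T -> R) (w : nat -> T -> R) : measurable_fun D s ->
    (forall n, sqr_integrable mu D (w n)) ->
    (forall e : R, 0 < e -> exists N, forall n, (N <= n)%N ->
     (\int[mu]_(t in D) ((s t - w n t) ^+ 2)%:E <= e%:E)%E) ->
    sqr_integrable mu D s.
  move=> ms hw /(_ 1 ltr01)[N /(_ N (leqnn N)) HN].
  rewrite [X in sqr_integrable _ _ X](_ : _ = fun t => (s t - w N t) + w N t).
    apply: sqr_integrableD => //; split; last exact: le_lt_trans HN (ltry _).
    by apply: measurable_funB => //; case: (hw N).
  by apply/funext => t; rewrite subrK.
exists v.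
  apply/scalar_L2P; rewrite rv iv; split.
    by apply: (fin _ (fun n => re (u n))) => // n; have /scalar_L2P[] := hu n.
  by apply: (fin _ (fun n => im (u n))) => // n; have /scalar_L2P[] := hu n.
move=> e e0.
have e20 : 0 < e / 2 by rewrite divr_gt0.
have [N1 H1] := rlim _ e20; have [N2 H2] := ilim _ e20.
exists (maxn N1 N2) => n; rewrite geq_max => /andP[n1 n2].
rewrite splitE ?rv ?iv // [e]splitr EFinD.
by apply: leeD; [exact: H1|exact: H2].
Qed.

End scalarL2.

(** * The Hilbert space S *)

Section S_structure.
Context {R : realType} {k : scalars}.
Local Notation F := (scalar_field R k).

(** S_rep becomes a function type only once the setting is known, so the vector
    space operations are given by cases. *)
Definition zeroS (P : pod_setting R) : S_rep k P :=
  match P return S_rep k P with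
  | Discrete _ _ => fun=> 0
  | Defs.Continuous _ _ _ => fun _ _ => 0
  end.

Definition lcombS (P : pod_setting R) (a : F) :
    S_rep k P -> S_rep k P -> S_rep k P :=
  match P return S_rep k P -> S_rep k P -> S_rep k P with
  | Discrete _ _ => fun u v j => a * u j + v j
  | Defs.Continuous _ _ _ => fun u v t j => a * u t j + v t j
  end.

Definition sqnormS (P : pod_setting R) (u : S_rep k P) : R :=
  re_part (dot_S u u).

Variable P : pod_setting R.
Implicit Types (u v w : S_rep k P) (a : F).

Lemma lcombS0 a : lcombS a (zeroS P) (zeroS P) = zeroS P.
Proof.
by case: P => [s g|d O m] /=; [apply/funext => j|
  apply/funext => t; apply/funext => j]; rewrite mulr0 addr0.
Qed.

Hypothesis hP : pod_setting_ok P.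

Lemma in_S0 : in_S (zeroS P).
Proof.
case: P hP => //= d Omega m [oO _] j.
exact: (scalar_L2_0 _ (open_Rn_measurable oO)).
Qed.

Lemma in_S_lcomb a u v : in_S u -> in_S v -> in_S (lcombS a u v).
Proof.
case: P hP u v => //= d Omega m [oO _] u v hu hv j.
by apply: (scalar_L2_lin (open_Rn_measurable oO) a (hu j) (hv j)).
Qed.

Lemma dot_S_linl a u v w : in_S u -> in_S v -> in_S w ->
  dot_S (lcombS a u v) w = a * dot_S u w + dot_S v w.
Proof.
case: P hP u v w => [s gamma _ u v w _ _ _|d Omega m [oO _] u v w hu hv hw] /=.
  rewrite mulr_sumr -big_split /=; apply: eq_bigr => j _; ring.
rewrite mulr_sumr -big_split /=; apply: eq_bigr => j _.
exact: (L2_dot_linl (open_Rn_measurable oO) a (hu j) (hv j) (hw j)).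
Qed.

Lemma conj_scalar_sum (I : Type) (r : seq I) (G : I -> F) :
  conj_scalar (\sum_(i <- r) G i) = \sum_(i <- r) conj_scalar (G i).
Proof.
apply: (big_morph _ (@conj_scalarD _ _)).
by rewrite -[in LHS]of_real0 conj_of_real of_real0.
Qed.

Lemma dot_SC u v : in_S u -> in_S v -> dot_S u v = conj_scalar (dot_S v u).
Proof.
case: P hP u v => [s gamma _ u v _ _|d Omega m [oO _] u v hu hv] /=;
  rewrite conj_scalar_sum; apply: eq_bigr => j _.
  by rewrite !conj_scalarM conj_scalarK conj_of_real; ring.
exact: (L2_dotC (open_Rn_measurable oO) (hu j) (hv j)).
Qed.

Lemma re_part_sum (I : Type) (r : seq I) (G : I -> F) :
  re_part (\sum_(i <- r) G i) = \sum_(i <- r) re_part (G i).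
Proof. exact: (big_morph _ (@re_partD _ _) (@re_part0 _ _)). Qed.

Lemma sqnormS_ge0 u : in_S u -> 0 <= sqnormS u.
Proof.
rewrite /sqnormS.
case: P hP u => [s gamma [_ g0] u _|d Omega m [oO _] u hu] /=;
  rewrite re_part_sum; apply: sumr_ge0 => j _.
  rewrite -mulrA mulr_conj -of_realM re_of_real.
  by rewrite mulr_ge0 ?sqr_ge0 // ltW.
rewrite -lee_fin (L2_dot_sqr (open_Rn_measurable oO) (hu j)).
by apply: integral_ge0 => t _; rewrite lee_fin sqr_ge0.
Qed.

Lemma dot_S0l w : in_S w -> dot_S (zeroS P) w = 0.
Proof.
move=> hw; have h0 := in_S0.
by rewrite -[in LHS](lcombS0 (-1)) dot_S_linl // mulN1r addNr.
Qed.

Lemma dot_S0r w : in_S w -> dot_S w (zeroS P) = 0.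
Proof.
move=> hw; rewrite dot_SC ?dot_S0l //; last exact: in_S0.
by apply: scalar_ext; rewrite !scalar_partE ?oppr0.
Qed.

Lemma dot_S_linr a u v w : in_S u -> in_S v -> in_S w ->
  dot_S w (lcombS a u v) = conj_scalar a * dot_S w u + dot_S w v.
Proof.
move=> hu hv hw; have huv := in_S_lcomb a hu hv.
rewrite dot_SC // dot_S_linl // conj_scalarD conj_scalarM.
by rewrite -!dot_SC.
Qed.

Lemma sqnormS_lcomb a u v : in_S u -> in_S v ->
  sqnormS (lcombS a u v) = scalar_abs a ^+ 2 * sqnormS u +
    2 * re_part (a * dot_S u v) + sqnormS v.
Proof.
move=> hu hv; rewrite /sqnormS dot_S_linl //; last exact: in_S_lcomb.
rewrite !dot_S_linr // [dot_S v u]dot_SC // scalar_abs_sqr !scalar_partE.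
have : im_part (dot_S u u) = 0.
  have := congr1 (@im_part _ _) (dot_SC hu hu); rewrite im_conj; lra.
by move=> ->; ring.
Qed.

(** Bessel's inequality for a single unit vector. *)
Lemma dot_S_le u v : in_S u -> in_S v -> dot_S v v = 1 ->
  scalar_abs (dot_S u v) ^+ 2 <= sqnormS u.
Proof.
move=> hu hv v1.
have := sqnormS_ge0 (in_S_lcomb (- dot_S u v) hv hu).
rewrite sqnormS_lcomb // [dot_S v u]dot_SC // mulNr mulr_conj.
rewrite re_partN re_of_real !scalar_abs_sqr !scalar_partE.
by rewrite /sqnormS v1 -of_real1 re_of_real; lra.
Qed.

End S_structure.

Section S_complete.
Context {R : realType} {k : scalars} (d : nat) (Omega : set (Rn R d)) (m : nat).
Let P := Defs.Continuous d Omega m.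
Hypothesis hP : pod_setting_ok P.

Lemma sqnormS_sum (u : S_rep k P) : in_S u ->
  (sqnormS u)%:E = (\sum_(j < m)
    \int[lebesgue_Rn R d]_(t in Omega) (scalar_abs (u t j) ^+ 2)%:E)%E.
Proof.
move=> hu; have mO := open_Rn_measurable (proj1 hP).
rewrite /sqnormS /= re_part_sum -sumEFin; apply: eq_bigr => j _.
exact: (L2_dot_sqr mO (hu j)).
Qed.

Lemma S_complete (u : nat -> S_rep k P) :
  (forall n, in_S (u n)) ->
  (forall e : R, 0 < e -> exists N, forall i j, (N <= i)%N -> (N <= j)%N ->
     sqnormS (lcombS (-1) (u j) (u i)) <= e) ->
  exists2 h : S_rep k P, in_S h &
    forall e : R, 0 < e -> exists N, forall n, (N <= n)%N ->
     sqnormS (lcombS (-1) (u n) h) <= e.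
Proof.
move=> hu cu; have mO := open_Rn_measurable (proj1 hP).
have diffE (v w : S_rep k P) j :
    (\int[lebesgue_Rn R d]_(t in Omega) (scalar_abs (v t j - w t j) ^+ 2)%:E =
     \int[lebesgue_Rn R d]_(t in Omega)
       (scalar_abs ((lcombS (-1) w v : S_rep k P) t j) ^+ 2)%:E)%E.
  by apply: eq_integral => t _; rewrite /= mulN1r addrC.
have comp j := @scalar_L2_complete _ _ _ k (lebesgue_Rn R d) Omega mO
  (fun n t => u n t j) (fun n => hu n j).
have {}comp j : exists h : Rn R d -> scalar_field R k,
   scalar_L2 (lebesgue_Rn R d) Omega h /\
   forall e : R, 0 < e -> exists N, forall n, (N <= n)%N ->
    (\int[lebesgue_Rn R d]_(t in Omega) (scalar_abs (h t - u n t j) ^+ 2)%:E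
      <= e%:E)%E.
  have [|h h1 h2] := comp j; last by exists h.
  move=> e /cu[N HN]; exists N => a b Na Nb.
  rewrite (diffE (u a) (u b)).
  apply: le_trans (_ : (sqnormS (lcombS (-1) (u b) (u a)))%:E <= _)%E; last first.
    by rewrite lee_fin HN.
  rewrite sqnormS_sum; last exact: in_S_lcomb.
  rewrite (bigD1 j) //=; apply: leeDl; apply: sume_ge0 => i _.
  by apply: integral_ge0 => t _; rewrite lee_fin sqr_ge0.
have [h Hh] := choice comp.
exists (fun t j => h j t); first by move=> j; exact: (Hh j).1.
move=> e e0; have m0 : (0 : R) < m%:R by rewrite ltr0n; exact: (proj2 hP).
have em : 0 < e / m%:R by rewrite divr_gt0.
have [N_ HN] := choice (fun j => (Hh j).2 _ em).
exists (\max_(j < m) N_ j)%N => n /bigmax_leqP Nn.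
rewrite -lee_fin sqnormS_sum; last first.
  by apply: in_S_lcomb => // j; exact: (Hh j).1.
apply: (@le_trans _ _ (\sum_(j < m) (e / m%:R)%:E)%E); last first.
  rewrite sumEFin sumr_const card_ord -[_ *+ m]mulr_natr -mulrA mulVf ?gt_eqF //.
  by rewrite mulr1.
apply: lee_sum => j _.
rewrite -(diffE (fun t j => h j t) (u n)); apply: HN; exact: Nn.
Qed.

End S_complete.

(** * Norm bounds for Bochner integrals *)

Section bochner_bound.
Context {d : measure_display} {T : measurableType d} {R : realType}.
Context {k : scalars}.
Local Notation F := (scalar_field R k).
Variables (mu : {measure set T -> \bar R}) (D : set T).
Hypothesis mD : measurable D.
Variable V : completeNormedModType F.
Variable dot : {dot V for @conj_scalar R k}.
Hypothesis hV : hilbert_dot dot.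
Local Notation simple := (simple_function mu D V).
Local Notation "'<<' u , v '>>'" := (rdot dot u v).

Lemma scalar_indicE (A : set T) t : (\1_A t : F) = of_real k (\1_A t).
Proof.
by rewrite !indicE; case: (_ \in _); rewrite ?of_real1 ?of_real0.
Qed.

(** The inner product of two simple functions is a finite combination of products
    of indicators; this gives measurability of norms through real functions
    only. *)
Lemma rdot_simple (s : simple) t v :
  << simple_eval s t, v >> =
  \sum_i \1_(simple_set (s:=s) i) t * << simple_val (s:=s) i, v >>.
Proof.
rewrite /simple_eval rdot_suml; apply: eq_bigr => i _.
by rewrite scalar_indicE rdotZl.
Qed.

Lemma measurable_rdot_simple (s : simple) v :
  measurable_fun D (fun t => << simple_eval s t, v >>).
Proof.
under eq_fun do rewrite rdot_simple.
apply: measurable_sum => i; apply: measurable_funM => //.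
by apply: measurable_indic; exact: simple_measurable.
Qed.

Lemma measurable_rdot_simple2 (s s' : simple) :
  measurable_fun D (fun t => << simple_eval s t, simple_eval s' t >>).
Proof.
under eq_fun do rewrite rdot_simple.
apply: measurable_sum => i; apply: measurable_funM.
  by apply: measurable_indic; exact: simple_measurable.
under eq_fun do rewrite rdotC.
exact: measurable_rdot_simple.
Qed.

Lemma measurable_rnorm_of_sqr (h : T -> V) :
  measurable_fun D (fun t => << h t, h t >>) ->
  measurable_fun D (fun t => rnorm (h t)).
Proof.
move=> mh.
rewrite (_ : (fun t => _) = (@Num.sqrt R) \o (fun t => << h t, h t >>)).
  apply: measurableT_comp => //.
  by apply: continuous_measurable_fun; exact: sqrt_continuous.
by apply/funext => t /=; rewrite rdot_sqr // sqrtr_sqr ger0_norm // rnorm_ge0.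
Qed.

Lemma measurable_rnorm_simple (s : simple) :
  measurable_fun D (fun t => rnorm (simple_eval s t)).
Proof.
by apply: measurable_rnorm_of_sqr; exact: measurable_rdot_simple2.
Qed.

Lemma measurable_rnorm_simpleB (s s' : simple) :
  measurable_fun D (fun t => rnorm (simple_eval s t - simple_eval s' t)).
Proof.
apply: measurable_rnorm_of_sqr.
rewrite (_ : (fun t => _) = fun t =>
    << simple_eval s t, simple_eval s t >> -
    2 * << simple_eval s t, simple_eval s' t >> +
    << simple_eval s' t, simple_eval s' t >>).
  apply: measurable_funD; last exact: measurable_rdot_simple2.
  apply: measurable_funB; first exact: measurable_rdot_simple2.
  by apply: measurable_funM => //; exact: measurable_rdot_simple2.
apply/funext => t.
by rewrite !rdotE [rdot dot (simple_eval s' t) _]rdotC; ring.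
Qed.

Lemma cvg_rnorm (u : nat -> V) (l v : V) : u n @[n --> \oo] --> l ->
  (rnorm (u n - v))%:E @[n --> \oo] --> (rnorm (l - v))%:E.
Proof.
move=> /cvg_rnormP ul; apply: cvg_EFin; first exact: nearW.
apply/cvgrPdist_lt => e /ul; apply: filterS => n /=.
apply: le_lt_trans; rewrite ler_norml; apply/andP; split.
  rewrite lerNl opprB lerBlDr [rnorm (l - u n)]rdistC.
  have -> : u n - v = (u n - l) + (l - v) by rewrite addrA subrK.
  exact: ler_rnormD.
rewrite lerBlDr; have -> : l - v = (l - u n) + (u n - v) by rewrite addrA subrK.
exact: ler_rnormD.
Qed.

Lemma measurable_rnorm_strongB (g : T -> V) (s : simple) :
  strongly_measurable mu D g ->
  measurable_fun D (fun t => rnorm (g t - simple_eval s t)).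
Proof.
move=> [s_ gs]; apply/measurable_EFinP.
apply: (@emeasurable_fun_cvg _ _ _ _
  (fun n t => (rnorm (simple_eval (s_ n) t - simple_eval s t))%:E)).
  by move=> n; apply/measurable_EFinP; exact: measurable_rnorm_simpleB.
by move=> t Dt; apply: cvg_rnorm; exact: gs.
Qed.

Lemma measurable_rnorm_strong (g : T -> V) :
  strongly_measurable mu D g -> measurable_fun D (fun t => rnorm (g t)).
Proof.
move=> [s_ gs]; apply/measurable_EFinP.
apply: (@emeasurable_fun_cvg _ _ _ _
  (fun n t => (rnorm (simple_eval (s_ n) t))%:E)).
  by move=> n; apply/measurable_EFinP; exact: measurable_rnorm_simple.
move=> t Dt; have := cvg_rnorm (v := 0) (gs t Dt).
by rewrite subr0; under eq_fun do rewrite subr0.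
Qed.

(** Pairing the integral I of a simple function with I itself reduces the bound
    to the scalar case. *)
Lemma rnorm_simple_integral (s : simple) :
  ((rnorm (simple_integral s))%:E <=
   \int[mu]_(t in D) (rnorm (simple_eval s t))%:E)%E.
Proof.
set I := simple_integral s.
have pos t : D t -> (0 <= (rnorm (simple_eval s t))%:E)%E.
  by move=> _; rewrite lee_fin rnorm_ge0.
have [I0|I0] := eqVneq (rnorm I) 0.
  by rewrite I0; apply: integral_ge0.
have {I0}Ip : 0 < rnorm I by rewrite lt0r I0 rnorm_ge0.
have indint i : mu.-integrable D
    (fun t => (\1_(simple_set (s:=s) i) t : R)%:E).
  apply/integrableP; split.
    by apply/measurable_EFinP; apply: measurable_indic; exact: simple_measurable.
  under eq_integral do rewrite gee0_abs ?lee_fin //.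
  rewrite integral_indic //; last exact: simple_measurable.
  by rewrite setIidl ?simple_finite //; exact: simple_sub.
have intind i : mu.-integrable D
    (fun t => (\1_(simple_set (s:=s) i) t * << simple_val (s:=s) i, I >>)%:E).
  by under eq_fun do rewrite EFinM; exact: integrableZr.
have E : (<< I, I >>)%:E = (\int[mu]_(t in D) (<< simple_eval s t, I >>)%:E)%E.
  under eq_integral do rewrite rdot_simple -sumEFin.
  rewrite integral_sum //.
  rewrite {1}/I /simple_integral rdot_suml -sumEFin; apply: eq_bigr => i _.
  rewrite rdotZl EFinM fineK; last first.
    by rewrite ge0_fin_numE //; exact: simple_finite.
  under eq_integral do rewrite EFinM.
  rewrite integralZr //.
  rewrite integral_indic //; last exact: simple_measurable.
  by rewrite setIidl //; exact: simple_sub.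
have : ((rnorm I * rnorm I)%:E <=
   (rnorm I)%:E * \int[mu]_(t in D) (rnorm (simple_eval s t))%:E)%E.
  rewrite -expr2 -(rdot_sqr hV) E.
  apply: le_trans (lee_abs _) _.
  apply: le_trans (le_abse_integral mu mD _) _.
    by apply/measurable_EFinP; exact: measurable_rdot_simple.
  rewrite -ge0_integralZl //; first last.
  - by rewrite lee_fin rnorm_ge0.
  - by apply/measurable_EFinP; exact: measurable_rnorm_simple.
  apply: ge0_le_integral => //.
  - apply: measurableT_comp => //.
    by apply/measurable_EFinP; exact: measurable_rdot_simple.
  - by apply/measurable_EFinP; apply: measurable_funM => //;
      exact: measurable_rnorm_simple.
  - move=> t _; rewrite -EFinM lee_fin mulrC.
    exact: ler_abs_rdot.
by rewrite EFinM lee_pmul2l.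
Qed.

(** The bound passes from simple functions to their limit in the mean.  A
    function without integral has integral 0 by convention, for which the bound
    is clear. *)
Lemma rnorm_bochner_integral_le (f : T -> V) (b : T -> R) :
  measurable_fun D b -> (forall t, D t -> 0 <= b t) ->
  {ae mu, forall t, D t -> rnorm (f t) <= b t} ->
  ((rnorm (bochner_integral mu D f))%:E <= \int[mu]_(t in D) (b t)%:E)%E.
Proof.
move=> mb b0 fb.
rewrite /bochner_integral; case: xgetP => [v _ /= [h [sh fh [s [sint slim]]]]|_];
  last by rewrite rnorm0; exact: integral_ge0.
have mh := measurable_rnorm_strong sh.
apply: (@le_trans _ _ (\int[mu]_(t in D) (rnorm (h t))%:E)%E); last first.
  apply: ae_ge0_le_integral => //; try exact/measurable_EFinP.
    by move=> t _; rewrite lee_fin rnorm_ge0.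
  move: fb fh; apply: filterS2 => t fb fh Dt.
  by rewrite lee_fin -(fh Dt); exact: fb.
apply/lee_addgt0Pr => e e0.
have e20 : 0 < e / 2 by rewrite divr_gt0.
move/fine_cvgP: sint => [sfin /cvgrPdist_lt sreal].
move/cvg_rnormP: slim => slim.
have [N _ HN] : \forall n \near \oo,
    (\int[mu]_(t in D) (rnorm (h t - simple_eval (s n) t))%:E <= (e / 2)%:E)%E /\
    rnorm (v - simple_integral (s n)) < e / 2.
  near=> n; split; last by near: n; exact: (slim _ e20).
  rewrite -(@fineK _ (integral _ _ _)); last by near: n.
  rewrite lee_fin; apply: le_trans (ler_norm _) _; rewrite ltW //.
  by rewrite -normrN -sub0r; near: n; exact: (sreal _ e20).
have [h1 h2] := HN N (leqnn N).
apply: (@le_trans _ _ ((e / 2)%:E + (rnorm (simple_integral (s N)))%:E)%E).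
  rewrite -EFinD lee_fin.
  rewrite -[X in rnorm X](subrK (simple_integral (s N))).
  by apply: le_trans (ler_rnormD _ _) _; rewrite lerD2r ltW.
have : (\int[mu]_(t in D) (rnorm (simple_eval (s N) t))%:E <=
   \int[mu]_(t in D) (rnorm (h t))%:E + (e / 2)%:E)%E.
  apply: (@le_trans _ _ (\int[mu]_(t in D) ((rnorm (h t))%:E +
     (rnorm (h t - simple_eval (s N) t))%:E))%E).
    apply: ge0_le_integral => //.
    - by move=> t _; rewrite lee_fin rnorm_ge0.
    - by apply/measurable_EFinP; exact: measurable_rnorm_simple.
    - apply: emeasurable_funD; apply/measurable_EFinP => //.
      exact: measurable_rnorm_strongB.
    - move=> t _; rewrite -EFinD lee_fin.
      have -> : simple_eval (s N) t = h t - (h t - simple_eval (s N) t).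
        by rewrite opprB addrC subrK.
      by apply: le_trans (ler_rnormD _ _) _; rewrite rnormN subKr.
  rewrite ge0_integralD //; try (by move=> t _; rewrite lee_fin rnorm_ge0);
    try exact/measurable_EFinP; last first.
    by apply/measurable_EFinP; exact: measurable_rnorm_strongB.
  exact: leeD2l.
move=> H; apply: (@le_trans _ _ ((e / 2)%:E +
    (\int[mu]_(t in D) (rnorm (h t))%:E + (e / 2)%:E))%E).
  by apply: leeD2l; apply: le_trans H; exact: rnorm_simple_integral.
by rewrite addeCA -EFinD -splitr.
Unshelve. all: by end_near. Qed.

End bochner_bound.

Section pod_bound.
Context {R : realType} {k : scalars}.
Local Notation F := (scalar_field R k).
Variables (V : completeNormedModType F) (dot : {dot V for @conj_scalar R k}).
Hypothesis hV : hilbert_dot dot.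

(** Since |f| |w| <= |f|^2 + |w|^2, the operator is bounded on every ball of
    S, which is all that linearity needs to give continuity. *)
Lemma pod_operator_bound d (Omega : set (Rn R d)) m
    (w : pod_data (Defs.Continuous d Omega m) V) :
  pod_setting_ok (Defs.Continuous d Omega m) ->
  (forall j, bochner_L2 (lebesgue_Rn R d) Omega (w j)) ->
  exists B : R, forall f : S_rep k (Defs.Continuous d Omega m), in_S f ->
    rnorm (pod_operator w f) <= sqnormS f + B.
Proof.
move=> hP hw; have mO := open_Rn_measurable (proj1 hP).
set mu := lebesgue_Rn R d in hw *.
have [g Hg] := choice hw.
have mg j : measurable_fun Omega (fun t => rnorm (g j t) ^+ 2).
  have [sg _ _] := Hg j.
  apply: measurable_funX. exact (measurable_rnorm_strong hV sg).
pose B j := fine (\int[mu]_(t in Omega) (rnorm (g j t) ^+ 2)%:E)%E.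
exists (\sum_j B j) => f hf.
rewrite -lee_fin EFinD sqnormS_sum // -sumEFin -big_split /=.
apply: (@le_trans _ _ (\sum_j (rnorm (bochner_integral mu Omega
    (fun t => f t j *: w j t)))%:E)%E).
  by rewrite sumEFin lee_fin ler_rnorm_sum.
apply: lee_sum => j _; have [sg wg fin] := Hg j.
have [mr mi _] := hf j.
have ma : measurable_fun Omega (fun t => scalar_abs (f t j) ^+ 2).
  under eq_fun do rewrite scalar_abs_sqr.
  by apply: measurable_funD; exact: measurable_funX.
rewrite /B fineK; last first.
  rewrite ge0_fin_numE //.
  by apply: integral_ge0 => t _; rewrite lee_fin sqr_ge0.
rewrite -ge0_integralD //; try exact/measurable_EFinP;
  try by move=> t _; rewrite lee_fin sqr_ge0.
under eq_integral do rewrite -EFinD.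
apply: (rnorm_bochner_integral_le mO hV).
- exact: measurable_funD.
- by move=> t _; rewrite addr_ge0 ?sqr_ge0.
apply: filterS wg => t wg Dt; rewrite rnormZ (wg Dt).
have := sqr_ge0 (scalar_abs (f t j) - rnorm (g j t)).
have := sqr_ge0 (scalar_abs (f t j)); have := sqr_ge0 (rnorm (g j t)).
by nra.
Qed.

End pod_bound.

(** * Singular value expansion and convergence of the projections *)

Section linear_dependence.
Variables (F : numFieldType) (V : lmodType F).

(** A row vector killed by the coefficient matrix is a linear relation between
    the v i, so this matrix has full row rank. *)
Lemma independent_in_span (n m : nat) (v : 'I_n -> V) (u : 'I_m -> V)
    (A : 'I_n -> 'I_m -> F) :
  linearly_independent v -> (forall i, v i = \sum_j A i j *: u j) ->
  (n <= m)%N.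
Proof.
move=> vfree vu; pose M := \matrix_(i, j) A i j.
suff /eqP <- : row_free M by exact: rank_leq_col.
apply/inj_row_free => x xM0; apply/rowP => i; rewrite mxE.
apply: (vfree (fun i => x 0 i)).
under eq_bigr do rewrite vu scaler_sumr.
rewrite exchange_big /= big1 // => j _.
under eq_bigr do rewrite scalerA.
rewrite -scaler_suml; have := congr1 (fun y : 'rV[F]_m => y 0 j) xM0.
rewrite !mxE; under eq_bigr do rewrite mxE.
by move=> ->; rewrite scale0r.
Qed.

End linear_dependence.

(** The range of K is contained in the span of the s data vectors.  Infinite rank
    thus occurs only when S is an L^2 space. *)
Lemma discrete_rank_finite (R : realType) (k : scalars)
    (V : normedModType (scalar_field R k)) s (gamma : 'I_s -> R)
    (w : pod_data (Discrete s gamma) V) : ~ has_rank (pod_operator w) None.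
Proof.
move=> /(_ s.+1)[g [_ free]].
have := @independent_in_span _ _ _ _ _ w
  (fun i j => of_real k (gamma j) * g i j) free (fun=> erefl).
by rewrite ltnn.
Qed.

Section pod_svd.
Variables (R : realType) (k : scalars).
Local Notation F := (scalar_field R k).
Variables (X Y : completeNormedModType F).
Variables (dotX : {dot X for @conj_scalar R k}).
Variables (dotY : {dot Y for @conj_scalar R k}).
Hypothesis hY : hilbert_dot dotY.
Variables (DL : set X) (L : X -> Y).
Hypothesis hL : linear_operator DL L.
Variable P : pod_setting R.
Hypothesis hP : pod_setting_ok P.
Variable w : pod_data P X.
Hypothesis hw : pod_data_ok DL L w.
Variables (sigma : nat -> R) (f : nat -> S_rep k P) (phi : nat -> X).
Hypothesis hsvd : is_svd dotX (pod_operator w) sigma f phi.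

Local Notation K := (pod_operator w).
Definition pod_image (g : S_rep k P) : Y := L (pod_operator w g).
Local Notation KY := pod_image.

Let coef (g : S_rep k P) i : F := of_real k (sigma i) * dot_S g (f i).

Lemma DL0 : DL 0. Proof. by case: hL. Qed.

Lemma DL_lin (a : F) x y : DL x -> DL y -> DL (a *: x + y).
Proof. by case: hL => _ H /H{}H /H{}H; case: (H a). Qed.

Lemma L_lin (a : F) x y : DL x -> DL y -> L (a *: x + y) = a *: L x + L y.
Proof. by case: hL => _ H /H{}H /H{}H; case: (H a). Qed.

Lemma L0 : L 0 = 0.
Proof.
by have := L_lin (-1) DL0 DL0; rewrite scaler0 addr0 scaleN1r addNr.
Qed.

Lemma LZ (a : F) x : DL x -> L (a *: x) = a *: L x.
Proof. by move=> Dx; have := L_lin a Dx DL0; rewrite L0 !addr0. Qed.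

Lemma DLZ (a : F) x : DL x -> DL (a *: x).
Proof. by move=> Dx; have := DL_lin a Dx DL0; rewrite addr0. Qed.

Lemma DL_sum (I : Type) (r : seq I) (Q : pred I) (G : I -> X) :
  (forall i, Q i -> DL (G i)) ->
  DL (\sum_(i <- r | Q i) G i) /\
  L (\sum_(i <- r | Q i) G i) = \sum_(i <- r | Q i) L (G i).
Proof.
move=> DG; elim/big_rec2: _ => [|i y x Qi [Dx <-]].
  by split; [exact: DL0|exact: L0].
have := DL_lin 1 (DG i Qi) Dx; have := L_lin 1 (DG i Qi) Dx.
by rewrite !scale1r.
Qed.

Lemma sigma_ge0 i : (0 < i)%N -> 0 <= sigma i.
Proof.
case: hsvd => mono _ _ _ _ i0; have /andP[s0 s1] := mono i i0.
exact: le_trans s1.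
Qed.

Lemma sigma_anti i j : (0 < i)%N -> (i <= j)%N -> sigma j <= sigma i.
Proof.
case: hsvd => mono _ _ _ _ i0; elim: j => [|j IH]; first by rewrite leqNgt i0.
rewrite leq_eqVlt => /predU1P[<-//|]; rewrite ltnS => ij.
apply: le_trans (IH ij); have /andP[] := mono j (leq_trans i0 ij).
by [].
Qed.

Lemma sigma_gt0_or i : (0 < i)%N -> 0 < sigma i \/ sigma i = 0.
Proof.
by move=> /sigma_ge0; rewrite le_eqVlt => /predU1P[<-|]; [right|left].
Qed.

Lemma pod_operator_svd g : in_S g ->
  \sum_(1 <= i < n) coef g i *: phi i @[n --> \oo] --> K g.
Proof. by case: hsvd => _ _ _ _; apply. Qed.

Lemma in_S_f i : (0 < i)%N -> 0 < sigma i -> in_S (f i).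
Proof. by case: hsvd => _ H _ _ _; apply: H. Qed.

Lemma dot_f i j : (0 < i)%N -> (0 < j)%N -> 0 < sigma i -> 0 < sigma j ->
  dot_S (f i) (f j) = (i == j)%:R.
Proof. by case: hsvd => _ _ H _ _; exact: H. Qed.

Lemma dot_phi i j : (0 < i)%N -> (0 < j)%N -> 0 < sigma i -> 0 < sigma j ->
  dotX (phi i) (phi j) = (i == j)%:R.
Proof. by case: hsvd => _ _ _ H _; exact: H. Qed.

(** The expansion determines K, so K inherits linearity from the inner
    product of S. *)
Lemma pod_operator_lin a g h : in_S g -> in_S h ->
  K (lcombS a g h) = a *: K g + K h.
Proof.
move=> hg hh.
have h1 := pod_operator_svd (in_S_lcomb hP a hg hh).
have h2 : \sum_(1 <= i < n) coef (lcombS a g h) i *: phi i @[n --> \oo] -->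
   a *: K g + K h.
  rewrite (_ : (fun n => _) = fun n =>
     a *: (\sum_(1 <= i < n) coef g i *: phi i) +
     \sum_(1 <= i < n) coef h i *: phi i).
    apply: cvgD (pod_operator_svd hh).
    exact: (@cvgZl_tmp _ _ _ _ _ a _ _ (pod_operator_svd hg)).
  apply/funext => n.
  rewrite scaler_sumr -big_split /=; apply: eq_big_nat => i /andP[i0 _].
  rewrite /coef; have [si|->] := sigma_gt0_or i0; last first.
    by rewrite of_real0 !mul0r !scale0r scaler0 addr0.
  rewrite dot_S_linl //; last exact: in_S_f.
  by rewrite mulrDr scalerDl scalerA mulrCA.
exact: (cvg_unique (@norm_hausdorff _ _) h1 h2).
Qed.

Lemma DL_pod_operator g : in_S g -> DL (K g).
Proof.
case: P hP w hw f hsvd g => [s gamma|d Omega m] hP' w' hw' f' _ g hg /=; last first.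
  by case: hw' => _ /(_ g hg)[].
by apply: (DL_sum _ _).1 => j _; exact: DLZ.
Qed.

Lemma pod_image_lin a g h : in_S g -> in_S h ->
  KY (lcombS a g h) = a *: KY g + KY h.
Proof.
move=> hg hh; rewrite /pod_image pod_operator_lin //.
by apply: L_lin; exact: DL_pod_operator.
Qed.

Lemma pod_operator_finite g N : in_S g ->
  (forall i, (N < i)%N -> sigma i = 0 \/ dot_S g (f i) = 0) ->
  K g = \sum_(1 <= i < N.+1) coef g i *: phi i.
Proof.
move=> hg H.
have h2 : \sum_(1 <= i < n) coef g i *: phi i @[n --> \oo] -->
    \sum_(1 <= i < N.+1) coef g i *: phi i.
  apply: cvg_near_cst; exists N.+1 => // n /= Nn.
  rewrite (big_cat_nat _ Nn) //=.
  rewrite [X in _ + X]big_nat_cond [X in _ + X]big1 ?addr0 //.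
  move=> i /andP[/andP[Ni _] _]; rewrite /coef.
  by have [->|->] := H i Ni; rewrite ?of_real0 ?mul0r ?mulr0 scale0r.
exact: (cvg_unique (@norm_hausdorff _ _) (pod_operator_svd hg) h2).
Qed.

Lemma pod_operator_f i : (0 < i)%N -> 0 < sigma i ->
  K (f i) = of_real k (sigma i) *: phi i.
Proof.
move=> i0 si; rewrite (@pod_operator_finite _ i) //; last 2 first.
- exact: in_S_f.
- move=> j ij; have j0 := ltn_trans i0 ij.
  have [sj|->] := sigma_gt0_or j0; last by left.
  by right; rewrite dot_f // ltn_eqF.
rewrite big_nat_recr //= big_nat_cond big1 ?add0r.
  by rewrite /coef dot_f // eqxx mulr1.
move=> j /andP[/andP[j0 ji] _]; rewrite /coef.
have [sj|->] := sigma_gt0_or j0; last by rewrite of_real0 mul0r scale0r.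
by rewrite dot_f // gtn_eqF // mulr0 scale0r.
Qed.

Lemma DL_phi i : (0 < i)%N -> 0 < sigma i -> DL (phi i).
Proof.
move=> i0 si; have := DL_pod_operator (in_S_f i0 si).
rewrite pod_operator_f // => /(DLZ (of_real k (sigma i)^-1)).
by rewrite scalerA -of_realM mulVf ?gt_eqF // of_real1 scale1r.
Qed.

Definition pod_partial_sum g N : Y :=
  \sum_(1 <= i < N.+1) coef g i *: L (phi i).

(** When sigma_i = 0 the vector phi_i may lie outside the domain of L, but then
    its coefficient vanishes. *)
Lemma L_partial_sum g N :
  DL (\sum_(1 <= i < N.+1) coef g i *: phi i) /\
  L (\sum_(1 <= i < N.+1) coef g i *: phi i) = pod_partial_sum g N.
Proof.
have term i : (0 < i)%N -> DL (coef g i *: phi i) /\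
    L (coef g i *: phi i) = coef g i *: L (phi i).
  move=> i0; rewrite /coef; have [si|->] := sigma_gt0_or i0.
    by split; [apply: DLZ|apply: LZ]; exact: DL_phi.
  by rewrite of_real0 mul0r !scale0r L0; split=> //; exact: DL0.
rewrite /pod_partial_sum big_nat_cond [in RHS]big_nat_cond.
have [|D E] := @DL_sum _ (index_iota 1 N.+1) (fun i => (1 <= i < N.+1)%N && true)
  (fun i => coef g i *: phi i).
  by move=> i /andP[/andP[i0 _] _]; exact: (term i i0).1.
split=> //; rewrite E; apply: eq_bigr => i /andP[/andP[i0 _] _].
exact: (term i i0).2.
Qed.

(** The images K f_i = sigma_i phi_i are orthogonal and nonzero. *)
Lemma rank_ge_of_sigma n : (0 < n)%N -> 0 < sigma n -> rank_ge K n.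
Proof.
move=> n0 sn.
have si (i : 'I_n) : 0 < sigma i.+1.
  by apply: lt_le_trans sn _; apply: sigma_anti.
exists (fun i => f i.+1); split=> [i|a]; first exact: in_S_f.
under eq_bigr do rewrite pod_operator_f // scalerA.
move=> sum0 i.
have := congr1 (fun x => dotX x (phi i.+1)) sum0.
rewrite dot_suml dot0l (bigD1 i) //= big1 ?addr0.
  rewrite dotZl dot_phi // eqxx mulr1 => /eqP.
  rewrite mulf_eq0 => /orP[/eqP//|/eqP s0].
  have : sigma i.+1 = 0 by apply: (@of_real_inj R k); rewrite s0 of_real0.
  by move=> e; have := si i; rewrite e ltxx.
move=> j ji; rewrite dotZl dot_phi // eqSS.
by rewrite (negbTE (_ : val j != val i)) ?mulr0.
Qed.

(** The range of K is spanned by phi_1, ..., phi_n. *)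
Lemma rank_lt_of_sigma n : sigma n.+1 = 0 -> ~ rank_ge K n.+1.
Proof.
move=> sn [g [hg free]].
have := @independent_in_span _ _ _ _ (fun i => K (g i)) (fun j : 'I_n => phi j.+1)
  (fun i j => coef (g i) j.+1) free.
rewrite ltnn => H; suff : false by []; apply: H => i.
rewrite (@pod_operator_finite _ n) //; first by rewrite big_add1 /= big_mkord.
move=> j nj; left; apply/eqP; rewrite eq_le sigma_ge0 ?(leq_ltn_trans (leq0n n) nj) //.
by rewrite andbT -sn; exact: sigma_anti.
Qed.

Lemma sigma_gt0_infinite_rank : has_rank K None ->
  forall i, (0 < i)%N -> 0 < sigma i.
Proof.
move=> rk [//|i] _; have [//|s0] := @sigma_gt0_or i.+1 isT.
by have := rank_lt_of_sigma s0 (rk i.+1).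
Qed.

Lemma sigma_finite_rank n : has_rank K (Some n) ->
  ((0 < n)%N -> 0 < sigma n) /\ (forall i, (n < i)%N -> sigma i = 0).
Proof.
move=> [rk rk']; split.
  case: n rk {rk'} => // n rk _; have [//|s0] := @sigma_gt0_or n.+1 isT.
  by have := rank_lt_of_sigma s0 rk.
move=> i ni; have [si|//] := @sigma_gt0_or i (leq_ltn_trans (leq0n n) ni).
suff /rk' [] : rank_ge K n.+1.
by apply: rank_ge_of_sigma => //; apply: lt_le_trans si _; exact: sigma_anti.
Qed.

Lemma pod_partial_sum_finite g N : in_S g ->
  (forall i, (N < i)%N -> sigma i = 0 \/ dot_S g (f i) = 0) ->
  KY g = pod_partial_sum g N.
Proof.
by move=> hg H; rewrite /pod_image (pod_operator_finite hg H) (L_partial_sum g N).2.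
Qed.

Section infinite_rank.
Hypothesis sigma_gt0 : forall i, (0 < i)%N -> 0 < sigma i.

Let in_Sf i : in_S (f i.+1). Proof. by apply: in_S_f => //; exact: sigma_gt0. Qed.

(** The component of g orthogonal to the first n right singular vectors, by
    Gram-Schmidt. *)
Fixpoint residual (g : S_rep k P) n : S_rep k P :=
  if n is n'.+1 then
    lcombS (- dot_S (residual g n') (f n)) (f n) (residual g n')
  else g.

Lemma in_S_residual g n : in_S g -> in_S (residual g n).
Proof. by move=> hg; elim: n => //= n IH; apply: in_S_lcomb. Qed.

Lemma dot_residual g n i : in_S g ->
  dot_S (residual g n) (f i.+1) = if (i < n)%N then 0 else dot_S g (f i.+1).
Proof.
move=> hg; elim: n i => [|n IH] i //=.
have hr := in_S_residual n hg.
rewrite dot_S_linl // dot_f //; try exact: sigma_gt0.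
rewrite !IH ltnn ltnS eqSS; case: (ltngtP i n) => [ni|ni|->].
- by rewrite mulr0 addr0.
- by rewrite mulr0 add0r.
- by rewrite mulr1 addNr.
Qed.

Lemma pod_image_residual g n : in_S g ->
  KY (residual g n) = KY g - pod_partial_sum g n.
Proof.
move=> hg; elim: n => [|n IH] /=.
  by rewrite /pod_partial_sum big_geq // subr0.
rewrite pod_image_lin //; last exact: in_S_residual.
rewrite IH dot_residual // ltnn.
have -> : KY (f n.+1) = of_real k (sigma n.+1) *: L (phi n.+1).
  rewrite /pod_image pod_operator_f //; last exact: sigma_gt0.
  by apply: LZ; apply: DL_phi => //; exact: sigma_gt0.
rewrite /pod_partial_sum [in RHS]big_nat_recr //= opprD /coef.
by rewrite scalerA mulNr scaleNr [_ * dot_S _ _]mulrC [LHS]addrC -addrA.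
Qed.

(** g and its m-th residual differ by a combination of f_1, ..., f_m, to which
    the n-th residual is orthogonal. *)
Lemma dot_residual_residual g m n : in_S g -> (m <= n)%N ->
  dot_S (residual g n) (residual g m) = dot_S (residual g n) g.
Proof.
move=> hg; elim: m => //= m IH mn.
rewrite dot_S_linr //; try exact: in_S_residual.
by rewrite !dot_residual // mn mulr0 add0r IH // ltnW.
Qed.

Lemma sqnormS_residualB g m n : in_S g -> (m <= n)%N ->
  sqnormS (lcombS (-1) (residual g n) (residual g m)) =
    sqnormS (residual g m) - sqnormS (residual g n) /\
  sqnormS (lcombS (-1) (residual g m) (residual g n)) =
    sqnormS (residual g m) - sqnormS (residual g n).
Proof.
move=> hg mn; have hm := in_S_residual m hg; have hn := in_S_residual n hg.
have e : dot_S (residual g n) (residual g m) = dot_S (residual g n) (residual g n).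
  by rewrite !dot_residual_residual.
rewrite !sqnormS_lcomb // [dot_S (residual g m) _]dot_SC // e.
have -> : scalar_abs (-1 : scalar_field R k) = 1.
  by apply: (@of_real_inj R k); rewrite -scalar_normE normrN1 of_real1.
by rewrite !mulN1r !re_partN re_conj -/(sqnormS (residual g n)); split; ring.
Qed.

(** By Pythagoras, sqnormS_residualB, the squared norms decrease and control the
    distances between residuals. *)
Lemma residual_cauchy g : in_S g ->
  forall e : R, 0 < e -> exists N, forall i j, (N <= i)%N -> (N <= j)%N ->
     sqnormS (lcombS (-1) (residual g j) (residual g i)) <= e.
Proof.
move=> hg e e0; pose N_ n := sqnormS (residual g n).
have mono : nonincreasing_seq N_.
  move=> m n mn; have [E _] := sqnormS_residualB hg mn.
  rewrite -subr_ge0 -E; apply: sqnormS_ge0 => //.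
  by apply: in_S_lcomb => //; exact: in_S_residual.
have c : cvgn N_.
  apply: nonincreasing_is_cvgn => //; exists 0 => _ [n _ <-].
  by apply: sqnormS_ge0 => //; exact: in_S_residual.
have e20 : 0 < e / 2 by rewrite divr_gt0.
have /cvgrPdist_lt/(_ _ e20)[N _ HN] := c.
have close i j : (N <= i)%N -> (N <= j)%N -> N_ i - N_ j <= e.
  move=> /HN /= hi /HN /= hj; move: hi hj.
  rewrite !ltr_distl => /andP[h1 h2] /andP[h3 h4]; lra.
exists N => i j Ni Nj; have [ij|/ltnW ji] := leqP i j.
  by have [-> _] := sqnormS_residualB hg ij; exact: close.
by have [_ ->] := sqnormS_residualB hg ji; exact: close.
Qed.

(** The residuals converge in the complete space S to some h orthogonal to
    every f_i.  Then K h = 0, hence L K h = 0, and continuity of L K carries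
    the convergence over to Y. *)
Lemma pod_partial_sum_cvg_infinite g (B : R) : in_S g ->
  (forall u : nat -> S_rep k P, (forall n, in_S (u n)) ->
    (forall e : R, 0 < e -> exists N, forall i j, (N <= i)%N -> (N <= j)%N ->
      sqnormS (lcombS (-1) (u j) (u i)) <= e) ->
    exists2 h : S_rep k P, in_S h &
      forall e : R, 0 < e -> exists N, forall n, (N <= n)%N ->
        sqnormS (lcombS (-1) (u n) h) <= e) ->
  (forall h, in_S h -> rnorm (KY h) <= sqnormS h + B) ->
  forall e : R, 0 < e -> exists N, forall n, (N <= n)%N ->
    rnorm (KY g - pod_partial_sum g n) < e.
Proof.
move=> hg complete bound e e0.
have [h hh hlim] := complete _ (fun n => in_S_residual n hg) (residual_cauchy hg).
have hr n := in_S_residual n hg.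
have hd n : in_S (lcombS (-1) (residual g n) h) by exact: in_S_lcomb.
have orth i : dot_S h (f i.+1) = 0.
  apply: scalar_abs0_eq0; apply/eqP; rewrite -sqrf_eq0 eq_le sqr_ge0 andbT.
  apply/ler_addgt0Pr => eps /hlim[N HN]; rewrite add0r.
  have := HN (maxn N i.+1) (leq_maxl _ _); apply: le_trans.
  have f1 : dot_S (f i.+1) (f i.+1) = 1.
    by rewrite dot_f ?eqxx //; exact: sigma_gt0.
  apply: le_trans (dot_S_le hP (hd _) (in_Sf i) f1).
  by rewrite dot_S_linl // dot_residual // leq_maxr mulr0 add0r.
have KYh : KY h = 0.
  rewrite (@pod_partial_sum_finite _ 0) //.
    by rewrite /pod_partial_sum big_geq.
  by move=> [//|i] _; right.
have KYd n : rnorm (KY (lcombS (-1) (residual g n) h)) =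
    rnorm (KY g - pod_partial_sum g n).
  by rewrite pod_image_lin // KYh addr0 scaleN1r rnormN pod_image_residual.
(* the bound for the vector t u, divided by t *)
have scaled t u : 0 < t -> in_S u -> rnorm (KY u) <= t * sqnormS u + B / t.
  move=> t0 hu; have h0 := in_S0 (k := k) hP.
  have := bound _ (in_S_lcomb hP (of_real k t) hu h0).
  have KY0 : KY (zeroS P) = 0.
    have := pod_image_lin (-1) h0 h0; rewrite lcombS0 scaleN1r => ->.
    by rewrite addNr.
  rewrite pod_image_lin // KY0 addr0 rnormZ sqnormS_lcomb //.
  rewrite dot_S0r // mulr0 re_part0 mulr0 addr0 {2}/sqnormS dot_S0r // re_part0.
  rewrite addr0 (scalar_abs_of_real (ltW t0)) => H.
  rewrite -(@ler_pM2l _ t) // mulrDr [t * (B / t)]mulrC divfK ?gt_eqF //.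
  by rewrite mulrA -expr2.
(* t makes the term B / t of that bound small, whatever u is *)
pose B' := `|B| + 1.
have B'0 : 0 < B' by rewrite ltr_wpDl.
pose t := 2 * B' / e.
have t0 : 0 < t by rewrite divr_gt0 ?mulr_gt0.
have [N HN] := hlim (e / 4 / t) ltac:(by apply: divr_gt0 => //; exact: divr_gt0).
exists N => n Nn; rewrite -KYd.
apply: le_lt_trans (scaled t _ t0 (hd n)) _.
have h1 : t * sqnormS (lcombS (-1) (residual g n) h) <= e / 4.
  by rewrite mulrC -ler_pdivlMr //; exact: HN.
have h2 : B / t <= e / 2.
  rewrite ler_pdivrMr //; have -> : e / 2 * t = B' by rewrite /t; field; lra.
  by rewrite /B' ler_wpDr // ler_norm.
lra.
Qed.

End infinite_rank.

Lemma pod_image_bound_complete : has_rank K None ->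
  (exists B : R, forall h : S_rep k P, in_S h -> rnorm (KY h) <= sqnormS h + B) /\
  (forall u : nat -> S_rep k P, (forall n, in_S (u n)) ->
    (forall e : R, 0 < e -> exists N, forall i j, (N <= i)%N -> (N <= j)%N ->
      sqnormS (lcombS (-1) (u j) (u i)) <= e) ->
    exists2 h : S_rep k P, in_S h &
      forall e : R, 0 < e -> exists N, forall n, (N <= n)%N ->
        sqnormS (lcombS (-1) (u n) h) <= e).
Proof.
rewrite /pod_image.
case: P hP w hw f hsvd => [s gamma|d Omega m] hP' w' hw' _ _ rk.
  by case: (discrete_rank_finite rk).
split; last by move=> u hu cu; exact: S_complete.
have [hd hKf] := hw'.
have [|B HB] := @pod_operator_bound _ _ _ dotY hY d Omega m
   (map_data (P := Defs.Continuous d Omega m) L w') hP'.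
  by move=> j; have [] := hd j.
by exists B => h hh; have [_ ->] := hKf h hh; exact: HB.
Qed.

Lemma pod_partial_sum_cvg sX g : has_rank K sX -> in_S g ->
  forall e : R, 0 < e -> exists N, forall n, (N <= n)%N ->
    rnorm (KY g - pod_partial_sum g n) < e.
Proof.
case: sX => [n|] rk hg e e0.
  have [_ s0] := sigma_finite_rank rk.
  exists n => N nN; rewrite (@pod_partial_sum_finite g N) //.
    by rewrite subrr rnorm0.
  by move=> i Ni; left; apply: s0; exact: leq_ltn_trans nN Ni.
have s0 := sigma_gt0_infinite_rank rk.
have [[B HB] complete] := pod_image_bound_complete rk.
exact: (pod_partial_sum_cvg_infinite s0 hg complete HB).
Qed.

Section projections.
Variable Pi : nat -> {linear Y -> Y}.
Hypothesis hPi : forall r, (0 < r)%N -> 0 < sigma r ->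
  bounded_projection_onto (Pi r) (L @` span_upto phi r).

Lemma projection_id r v : (0 < r)%N -> 0 < sigma r ->
  (L @` span_upto phi r) v -> Pi r v = v.
Proof.
move=> r0 sr; have [_ idem <-] := hPi r0 sr.
by move=> [u _ <-]; exact: idem.
Qed.

Lemma projection_phi r i : (0 < i <= r)%N -> 0 < sigma r ->
  Pi r (L (phi i)) = L (phi i).
Proof.
move=> /andP[i0 ir] sr; apply: projection_id => //; first exact: leq_trans ir.
exists (phi i) => //; exists (fun j => (j == i)%:R).
rewrite (bigD1_seq i) /= ?iota_uniq ?mem_index_iota ?i0 ?ltnS //.
rewrite eqxx scale1r big1 ?addr0 // => j ji.
by rewrite (negbTE ji) scale0r.
Qed.

Lemma projection_partial_sum r g : (0 < r)%N -> 0 < sigma r ->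
  Pi r (pod_partial_sum g r) = pod_partial_sum g r.
Proof.
move=> r0 sr; rewrite /pod_partial_sum linear_sum.
apply: eq_big_nat => i /andP[i0 ir].
by rewrite linearZ /= projection_phi // i0.
Qed.

(** On the partial sum up to N only the terms beyond r are moved by Pi r. *)
Lemma projection_partial_sum_error r g N : (0 < r)%N -> 0 < sigma r -> (r <= N)%N ->
  rnorm (Pi r (pod_partial_sum g N) - pod_partial_sum g N) <=
  \sum_(r.+1 <= i < N.+1) sigma i * scalar_abs (dot_S g (f i)) *
     rnorm (Pi r (L (phi i)) - L (phi i)).
Proof.
move=> r0 sr rN.
rewrite /pod_partial_sum linear_sum -sumrB (big_cat_nat _ (_ : (r.+1 <= N.+1)%N)) //=.
rewrite [X in X + _]big_nat_cond big1 ?add0r; last first.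
  by move=> i /andP[/andP[i0 ir] _]; rewrite linearZ /= projection_phi ?subrr ?i0.
apply: le_trans (ler_rnorm_sum _ _ _) _.
apply: ler_sum_nat => i /andP[ri _].
rewrite linearZ /= -scalerBr rnormZ /coef scalar_absM scalar_abs_of_real //.
by apply: sigma_ge0; exact: leq_ltn_trans ri.
Qed.

Lemma ge0_operator_norm_le (A : Y -> Y) (C : R) :
  operator_norm_le A C -> operator_norm_le A `|C|.
Proof.
move=> H v; apply: le_trans (H v) _; rewrite ler_wpM2r ?rnorm_ge0 //.
exact: ler_norm.
Qed.

Lemma operator_normB_le (A : {linear Y -> Y}) (C : R) v : operator_norm_le A C ->
  rnorm (A v - v) <= (C + 1) * rnorm v.
Proof.
move=> H; apply: le_trans (ler_rnormD _ _) _.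
by rewrite rnormN mulrDl mul1r lerD2r.
Qed.

Lemma projection_error_bound sX g r : has_rank K sX -> in_S g ->
  (0 < r)%N -> 0 < sigma r ->
  ((rnorm (Pi r (KY g) - KY g))%:E <=
   \sum_(r.+1 <= i <oo)
     (sigma i * scalar_abs (dot_S g (f i)) *
      rnorm (Pi r (L (phi i)) - L (phi i)))%:E)%E.
Proof.
move=> rk hg r0 sr; have [[C /ge0_operator_norm_le HC] _ _] := hPi r0 sr.
apply/lee_addgt0Pr => e e0; pose c := `|C| + 1.
have c0 : 0 < c by rewrite ltr_wpDl.
have ec0 : 0 < e / c by rewrite divr_gt0.
have [N HN] := pod_partial_sum_cvg rk hg ec0.
pose M := maxn N r; have {}HN := HN M (leq_maxl _ _).
set S := (X in (_ <= X + _)%E).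
have h1 : ((rnorm (Pi r (pod_partial_sum g M) - pod_partial_sum g M))%:E <= S)%E.
  apply: (@le_trans _ _ (\sum_(r.+1 <= i < M.+1)
      (sigma i * scalar_abs (dot_S g (f i)) *
       rnorm (Pi r (L (phi i)) - L (phi i)))%:E)%E).
    rewrite sumEFin lee_fin; apply: projection_partial_sum_error => //.
    exact: leq_maxr.
  apply: nneseries_lim_ge => i ri _; rewrite lee_fin.
  rewrite !mulr_ge0 ?scalar_abs_ge0 ?rnorm_ge0 // sigma_ge0 //.
  exact: leq_ltn_trans ri.
apply: le_trans (leeD2r _ h1).
rewrite -EFinD lee_fin.
pose y := KY g; pose z := pod_partial_sum g M.
have -> : Pi r (KY g) - KY g = (Pi r z - z) + (Pi r (y - z) - (y - z)).
  by rewrite linearB /= opprB addrACA [z - y]addrC addrA subrKC addrACA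
    [- z + _]addrC subrr addr0 addrC.
apply: le_trans (ler_rnormD _ _) _; rewrite lerD2l.
apply: le_trans (operator_normB_le _ HC) _.
by rewrite mulrC -ler_pdivlMr // ltW.
Qed.

Lemma pod_image_fixed n g : has_rank K (Some n) -> (0 < n)%N -> in_S g ->
  Pi n (KY g) = KY g.
Proof.
move=> rk n0 hg; have [/(_ n0) sn s0] := sigma_finite_rank rk.
rewrite (@pod_partial_sum_finite g n) ?projection_partial_sum //.
by move=> i ni; left; exact: s0.
Qed.

Variable sX : option nat.
Hypothesis rk : has_rank K sX.
Hypothesis hbound : sX = None ->
  exists C : R, forall r, (0 < r)%N -> 0 < sigma r -> operator_norm_le (Pi r) C.

Lemma projection_cvg g : in_S g ->
  converges_with_rank sX (fun r => Pi r (KY g)) (KY g).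
Proof.
move=> hg; case: sX rk hbound => [n|] rk' bnd /=.
  by move=> n0; exact: pod_image_fixed.
have s0 := sigma_gt0_infinite_rank rk'.
have [C HC] := bnd erefl; apply/cvg_rnormP => e e0.
pose c := `|C| + 1; have c0 : 0 < c by rewrite ltr_wpDl.
have ec0 : 0 < e / c by rewrite divr_gt0.
have [N HN] := pod_partial_sum_cvg rk' hg ec0.
exists (maxn N 1) => // r /=; rewrite geq_max => /andP[Nr r0].
have sr := s0 r r0; rewrite rdistC.
pose z := pod_partial_sum g r.
have -> : Pi r (KY g) - KY g = Pi r (KY g - z) - (KY g - z).
  by rewrite linearB /= projection_partial_sum // opprB addrA subrK.
apply: le_lt_trans (operator_normB_le _ (ge0_operator_norm_le (HC r r0 sr))) _.
by rewrite mulrC -ltr_pdivlMr //; exact: HN.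
Qed.

(** A vector orthogonal to the range of T = L K lies in the kernel of the
    adjoint, so it would be an eigenvector of T T^* for the eigenvalue 0. *)
Lemma pod_image_dense :
  (forall lambda : F, pod_eigenvalue dotY KY lambda -> lambda != 0) ->
  forall (y : Y) (e : R), 0 < e ->
    exists2 g, in_S g & rnorm (y - KY g) < e.
Proof.
move=> hev y e e0; have h0 := in_S0 (k := k) hP.
have KY0 : KY (zeroS P) = 0.
  have := pod_image_lin (-1) h0 h0; rewrite lcombS0 scaleN1r => ->.
  by rewrite addNr.
pose W : set Y := [set z | exists2 g, in_S g & z = KY g].
have [||z orth|_ [g hg ->] H] := @hilbert_dense _ _ _ _ hY W _ _ _ y e e0.
- by exists (zeroS P).
- move=> a _ _ [g hg ->] [h hh ->]; exists (lcombS a g h); first exact: in_S_lcomb.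
  by rewrite pod_image_lin.
- have [//|z0] := eqVneq z 0; exfalso.
  suff /hev : pod_eigenvalue dotY KY 0 by rewrite eqxx.
  exists z; split=> //; exists (zeroS P); last by rewrite KY0 scale0r.
  split=> // g hg; rewrite dot_S0r //; apply: orth.
  by exists g.
by exists g.
Qed.

Lemma projection_cvg_all :
  (forall lambda : F, pod_eigenvalue dotY KY lambda -> lambda != 0) ->
  forall y : Y, converges_with_rank sX (fun r => Pi r y) y.
Proof.
move=> hev y; have dense := pod_image_dense hev y; have cvgK := projection_cvg.
case: sX rk hbound cvgK => [n|] rk' bnd cvgK /=.
  move=> n0; have [/(_ n0) sn _] := sigma_finite_rank rk'.
  have [[C /ge0_operator_norm_le HC] _ _] := hPi n0 sn.
  apply/eqP; rewrite -subr_eq0; apply/eqP/rnorm_eq0/eqP.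
  rewrite eq_le rnorm_ge0 andbT; apply/ler_addgt0Pr => e e0; rewrite add0r.
  pose c := `|C| + 1; have c0 : 0 < c by rewrite ltr_wpDl.
  have ec0 : 0 < e / c by rewrite divr_gt0.
  have [g hg H] := dense _ ec0.
  have -> : Pi n y - y = Pi n (y - KY g) - (y - KY g).
    by rewrite linearB /= pod_image_fixed // opprB addrA subrK.
  apply: le_trans (operator_normB_le _ HC) _.
  by rewrite mulrC -ler_pdivlMr // ltW.
have s0 := sigma_gt0_infinite_rank rk'.
have [C HC] := bnd erefl; apply/cvg_rnormP => e e0.
pose c := `|C| + 1; have c0 : 0 < c by rewrite ltr_wpDl.
have ec0 : 0 < e / 2 / c by rewrite !divr_gt0.
have e20 : 0 < e / 2 by rewrite divr_gt0.
have [g hg H] := dense _ ec0.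
have /cvg_rnormP/(_ _ e20)[N _ HN] := cvgK _ hg.
exists (maxn N 1) => // r /=; rewrite geq_max => /andP[Nr r0].
have sr := s0 r r0; rewrite rdistC.
have -> : Pi r y - y = (Pi r (y - KY g) - (y - KY g)) + (Pi r (KY g) - KY g).
  by rewrite linearB /= opprB [RHS]addrC [RHS]addrCA !subrKA.
apply: le_lt_trans (ler_rnormD _ _) _; rewrite [e]splitr; apply: ltrD.
  apply: le_lt_trans (operator_normB_le _ (ge0_operator_norm_le (HC r r0 sr))) _.
  by rewrite mulrC -ltr_pdivlMr.
by rewrite rdistC; exact: HN.
Qed.

End projections.
End pod_svd.

Theorem theorem6p5 (R : realType) (k : scalars)
  (X Y : completeNormedModType (scalar_field R k))
  (dotX : {dot X for @conj_scalar R k}) (dotY : {dot Y for @conj_scalar R k})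
  (hX : hilbert_dot dotX) (hY : hilbert_dot dotY)
  (sepX : separable_space X) (sepY : separable_space Y)
  (DL : set X) (L : X -> Y) (hL : linear_operator DL L)
  (P : pod_setting R) (hP : pod_setting_ok P)
  (w : pod_data P X) (hw : pod_data_ok DL L w)
  (sigma : nat -> R) (f : nat -> S_rep k P) (phi : nat -> X)
  (hsvd : is_svd dotX (pod_operator w) sigma f phi)
  (sX : option nat) (hsX : has_rank (pod_operator w) sX)
  (Pi : nat -> {linear Y -> Y})
  (hPi : forall r, (0 < r)%N -> 0 < sigma r ->
     bounded_projection_onto (Pi r) (L @` span_upto phi r))
  (hbound : sX = None -> exists C : R, forall r, (0 < r)%N -> 0 < sigma r ->
     operator_norm_le (Pi r) C) :
  let KY := fun g : S_rep k P => L (pod_operator w g) in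
  (forall (g : S_rep k P) (y : Y), in_S g -> y = KY g ->
     converges_with_rank sX (fun r => Pi r y) y /\
     (forall r, (0 < r)%N -> 0 < sigma r ->
        ((rnorm (Pi r y - y))%:E <=
         \sum_(r.+1 <= i <oo)
           (sigma i * scalar_abs (dot_S g (f i)) *
            rnorm (Pi r (L (phi i)) - L (phi i)))%:E)%E)) /\
  ((forall lambda : scalar_field R k, pod_eigenvalue dotY KY lambda -> lambda != 0) ->
   forall y : Y, converges_with_rank sX (fun r => Pi r y) y).
Proof.
move=> KY; split; last exact: (projection_cvg_all hY hL hP hw hsvd hPi hsX hbound).
move=> g y hg ->; split.
  exact: (projection_cvg hY hL hP hw hsvd hPi hsX hbound hg).
move=> r r0 sr.
exact: (projection_error_bound hY hL hP hw hsvd hPi hsX hg r0 sr).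
Qed.
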